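(* Let $f$ be a non-vanishing function on $\partial\mathcal{D}_1$ such that $f$ and $\ln f$ are holomorphic on some open neighbourhood of $\partial\mathcal{D}_1$. Let $n=n_-+n_+$ and let $$p_a=1-p_a^-,\quad h_a=h_a^-\quad (a=1,\dots,n_-),\qquad p_{a+n_-}=p_a^++N,\quad h_{a+n_-}=N+1-h_a^+\quad (a=1,\dots,n_+),$$ where the integers $p_a^\pm\ge 1$ and $h_a^\pm\ge 1$ are independent of $N$, the $p_a$ being pairwise distinct and the $h_a$ being pairwise distinct elements of $\{1,\dots,N\}$. Let $M=(M_{ab})_{1\le a,b\le n}$ be the matrix $$M_{ab}=-\mathbf{1}_{\mathbb{N}}(p_a)\oint_{\partial\mathcal{D}_{\eta_z}}\frac{dz}{2i\pi}\oint_{\partial\mathcal{D}_{\eta_s}}\frac{ds}{2i\pi}\,\frac{\alpha(z)}{\alpha(s)}\cdot\frac{s^{N-p_a}z^{h_b-N-1}}{z-s}+\mathbf{1}_{\mathbb{N}}(-p_a)\oint_{\partial\mathcal{D}_{\eta_z^{-1}}}\frac{dz}{2i\pi}\oint_{\partial\mathcal{D}_{\eta_s^{-1}}}\frac{ds}{2i\pi}\,\frac{\alpha(s)}{\alpha(z)}\cdot\frac{s^{-p_a}z^{h_b-1}}{z-s},$$ and let $M^{(+)}$ (of size $n_+\times n_+$) and $M^{(-)}$ (of size $n_-\times n_-$) be the matrices $$M^{(+)}_{ab}=-\oint_{\partial\mathcal{D}_{\eta_z}}\frac{dz}{2i\pi}\oint_{\partial\mathcal{D}_{\eta_s}}\frac{ds}{2i\pi}\,\frac{s^{-p_a^+}z^{-h_b^+}}{z-s}\cdot\frac{\alpha(z)}{\alpha(s)},\qquad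 M^{(-)}_{ab}=\oint_{\partial\mathcal{D}_{\eta_z^{-1}}}\frac{dz}{2i\pi}\oint_{\partial\mathcal{D}_{\eta_s^{-1}}}\frac{ds}{2i\pi}\,\frac{s^{p_a^--1}z^{h_b^--1}}{z-s}\cdot\frac{\alpha(s)}{\alpha(z)},$$ with $1>\eta_z>\eta_s>0$. Provided that the matrices $M^{(\pm)}$ are not singular, one has, as $N\to\infty$, $$\det_n\big[M_{ab}\big]=\det_{n_+}\big[M^{(+)}_{ab}\big]\cdot\det_{n_-}\big[M^{(-)}_{ab}\big]\cdot\Big(1+O\big(N^{-\infty}\big)\Big).$$
   Context: $\mathcal{D}_\eta$ is the open disc of radius $\eta$ centred at $0$ and $\partial\mathcal{D}_\eta$ is its counter-clockwise oriented boundary. For a function $g$ on the unit circle, $c_m[g]=\oint_{\partial\mathcal{D}_1}\frac{g(z)}{z^{m+1}}\frac{dz}{2i\pi}$, $m\in\mathbb{Z}$. $\ln f$ denotes a holomorphic logarithm of $f$. The piecewise analytic function $\alpha$ is $$\alpha(z)=\exp\Big\{-\sum_{m\ge 0}c_m[\ln f]\,z^m\Big\}\ \text{ for } |z|<1,\qquad \alpha(z)=\exp\Big\{\sum_{m\ge 1}c_{-m}[\ln f]\,z^{-m}\Big\}\ \text{ for } |z|>1 .$$ $\mathbf{1}_{\mathbb{N}}$ is the indicator function of $\mathbb{N}=\{0,1,2,\dots\}$; $\det_k$ denotes a determinant of size $k$. $O(N^{-\infty})$ denotes a quantity that is $O(N^{-m})$ as $N\to\infty$ for every $m>0$. *)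

(* Defs.v *)
From HB Require Import structures.
From mathcomp Require Import all_boot all_order all_algebra.
From mathcomp Require Import all_classical all_reals all_analysis.
From mathcomp Require Import complex.

Set Implicit Arguments.
Unset Strict Implicit.
Unset Printing Implicit Defensive.

Import Order.TTheory GRing.Theory Num.Theory.
Import numFieldNormedType.Exports.

Local Open Scope classical_set_scope.
Local Open Scope complex_scope.
Local Open Scope ring_scope.

Section ComplexAnalysis.
Variable R : realType.

(* [R[i]] carries its topology and its normed-module structure over itself
   through the alias [R[i]^o], so [derivable f z 1] is complex
   differentiability at [z]. *)
Definition holomorphic_on (U : set R[i]) (f : R[i] -> R[i]) : Prop :=
  forall z : R[i], U z -> derivable (f : R[i]^o -> R[i]^o) z 1.

Definition open_nbhs_unit_circle (U : set R[i]) : Prop :=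
  open (U : set R[i]^o) /\ (forall z : R[i], `|z| = 1 -> U z).

Definition Cexp (z : R[i]) : R[i] :=
  (expR (complex.Re z))%:C * (cos (complex.Im z) +i* sin (complex.Im z)).

Definition holomorphic_log (U : set R[i]) (f lnf : R[i] -> R[i]) : Prop :=
  holomorphic_on U lnf /\ (forall z : R[i], U z -> Cexp (lnf z) = f z).

Definition Cintegral (a b : R) (g : R -> R[i]) : R[i] :=
  (\int[@lebesgue_measure R]_(t in `[a, b]) complex.Re (g t))
  +i* (\int[@lebesgue_measure R]_(t in `[a, b]) complex.Im (g t)).

Definition circle_point (r t : R) : R[i] := r%:C * (cos t +i* sin t).

(* Integral of [g] against [dz / (2 i pi)] over the counter-clockwise circle of
   radius [r] centred at 0; the normalization is included. *)
Definition oint (r : R) (g : R[i] -> R[i]) : R[i] :=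
  (2 * 'i%C * pi%:C)^-1 *
  Cintegral 0 (2 * pi)
    (fun t => g (circle_point r t) * ('i%C * circle_point r t)).

Definition laurent_coef (g : R[i] -> R[i]) (m : int) : R[i] :=
  oint 1 (fun z => g z / z ^ (m + 1)).

(* The argument is the logarithm [ln f]. The value 0 on the unit circle, where
   alpha is not defined, is arbitrary. *)
Definition alpha (lnf : R[i] -> R[i]) (z : R[i]) : R[i] :=
  if `|z| < 1 then
    Cexp (- limn (fun k => \sum_(0 <= m < k)
                     laurent_coef lnf m%:Z * z ^ m%:Z : R[i]^o))
  else if 1 < `|z| then
    Cexp (limn (fun k => \sum_(1 <= m < k)
                   laurent_coef lnf (- m%:Z) * z ^ (- m%:Z) : R[i]^o))
  else 0.

Definition indN (k : int) : R[i] := if 0 <= k then 1 else 0.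

Definition bigO_inv_powers (u : nat -> R[i]) : Prop :=
  forall m : nat, (0 < m)%N ->
    (u : nat -> R[i]^o) =O_\oo (fun N : nat => N%:R ^- m : R[i]^o).

End ComplexAnalysis.

Section Matrices.
Variables (R : realType) (lnf : R[i] -> R[i]) (etaz etas : R).

Let al : R[i] -> R[i] := alpha lnf.

Definition Mmx (N n : nat) (p h : 'I_n -> int) : 'M[R[i]]_n :=
  \matrix_(a < n, b < n)
    (- indN R (p a) *
       oint etaz (fun z => oint etas (fun s =>
         al z / al s *
         (s ^ (N%:Z - p a) * z ^ (h b - N%:Z - 1) / (z - s))))
     + indN R (- p a) *
       oint etaz^-1 (fun z => oint etas^-1 (fun s =>
         al s / al z *
         (s ^ (- p a) * z ^ (h b - 1) / (z - s))))).

Definition Mplus (n : nat) (pp hp : 'I_n -> int) : 'M[R[i]]_n :=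
  \matrix_(a < n, b < n)
    - oint etaz (fun z => oint etas (fun s =>
        s ^ (- pp a) * z ^ (- hp b) / (z - s) * (al z / al s))).

Definition Mminus (n : nat) (pm hm : 'I_n -> int) : 'M[R[i]]_n :=
  \matrix_(a < n, b < n)
    oint etaz^-1 (fun z => oint etas^-1 (fun s =>
      s ^ (pm a - 1) * z ^ (hm b - 1) / (z - s) * (al s / al z))).

End Matrices.

Section Indices.
Variables nm np : nat.

(* [fintype.split] separates the first [nm] indices from the last [np] ones. *)
Definition particles (pm : 'I_nm -> int) (pp : 'I_np -> int) (N : nat)
    (a : 'I_(nm + np)) : int :=
  match fintype.split a with
  | inl i => 1 - pm i
  | inr j => pp j + N%:Z
  end.

Definition holes (hm : 'I_nm -> int) (hp : 'I_np -> int) (N : nat)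
    (a : 'I_(nm + np)) : int :=
  match fintype.split a with
  | inl i => hm i
  | inr j => N%:Z + 1 - hp j
  end.

Definition admissible (pm : 'I_nm -> int) (pp : 'I_np -> int)
    (hm : 'I_nm -> int) (hp : 'I_np -> int) (N : nat) : Prop :=
  [/\ injective (particles pm pp N),
      injective (holes hm hp N) &
      forall a, 1 <= holes hm hp N a <= N%:Z].

End Indices.

(* Main.v *)
Require Import Defs.
From HB Require Import structures.
From mathcomp Require Import all_boot all_order all_algebra.
From mathcomp Require Import all_classical all_reals all_analysis.
From mathcomp Require Import perm complex ring lra.

Set Implicit Arguments.
Unset Strict Implicit.
Unset Printing Implicit Defensive.

Import Order.TTheory GRing.Theory Num.Theory.
Import numFieldNormedType.Exports.
Import ComplexField.Normc.

Local Open Scope classical_set_scope.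
Local Open Scope complex_scope.
Local Open Scope ring_scope.

(** Let [c_m] be the Laurent coefficients of [ln f]. Inside the unit disc
    [alpha = exp (- T)] with [T] a power series in [z], outside
    [1 / alpha = exp (- T')] with [T'] a power series in [1 / z]. As [ln f] is
    holomorphic near the unit circle, the circle defining [c_m] can be moved
    slightly inwards or outwards, which gives [|c_m| <= A exp (- d |m|)] for some
    [d > 0] (laurent_coef_decay). So both branches of [alpha] extend
    holomorphically and without zeros across the unit circle, [T] to the disc of
    radius [exp d] and [T'] to the complement of the disc of radius [exp (- d)].

    Inside, expand the kernel as [1 / (z - s) = \sum_j s ^ j z ^ (- j - 1)]. The
    double integral of [(alpha z / alpha s) s ^ u z ^ v / (z - s)] becomes a
    series of products of an integral in [z] by an integral in [s]
    (normc_double_oint_le). In the first factor the circle is moved from [etaz] to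
    [r = exp (d / 2) > 1] (normc_oint_exp_pseries_le); the second is estimated
    where it stands. The result is a bound [K r ^ v etas ^ u] with [K] independent
    of [u] and [v] (inside_bound), and symmetrically outside (outside_bound).

    These two bounds decide every entry of [M]. With the negative indices
    first, the diagonal blocks of [M] are [Mminus] and [Mplus], up to the term
    carrying [s ^ N] when some [p_a = 0]; the off-diagonal blocks carry
    [z ^ (- N)] inside, [z ^ N] outside, or again [s ^ N]. All these terms are
    [O (q ^ N)] with [q = max (1 / r, etas) < 1] (geo_close_Mmx). The determinant
    is a polynomial in the entries, hence [\det M = \det M+ \det M- + O (q ^ N)],
    and dividing by the nonzero limit gives a relative error which is
    exponentially small, in particular [O (N ^ (- m))] for every [m].

    Only complex differentiability of [ln f] is given, so moving contours rests
    on Goursat's form of Cauchy's theorem (Goursat_rectangle), applied in the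
    coordinates [z = exp (x + it)], which turn an annulus into a rectangle
    (oint_shift). *)

(** * The modulus, the topology and the exponential of the complex numbers *)

Section ComplexModulus.
Variable R : realType.
Implicit Types (z w : R[i]) (x y e : R).

Lemma normrE z : `|z| = (normc z)%:C.
Proof. by []. Qed.

Lemma normc_ge0 z : 0 <= normc z.
Proof. by rewrite -ler0c -normrE normr_ge0. Qed.

Lemma normc_triangle z w : normc (z + w) <= normc z + normc w.
Proof. exact: le_normcD. Qed.

Lemma normc_opp z : normc (- z) = normc z.
Proof. exact: normcN. Qed.

Lemma normc_distC z w : normc (z - w) = normc (w - z).
Proof. by rewrite -normc_opp opprB. Qed.

Lemma normc_sub z w : normc (z - w) <= normc z + normc w.
Proof. by rewrite -(normc_opp w) normc_triangle. Qed.

Lemma normc_real x : normc x%:C = `|x|.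
Proof. by rewrite /normc /= expr0n addr0 sqrtr_sqr. Qed.

Lemma normc_i : normc ('i%C : R[i]) = 1.
Proof. by rewrite /normc /= expr0n add0r expr1n sqrtr1. Qed.

Lemma normc_eq0 z : (normc z == 0) = (z == 0).
Proof. by apply/eqP/eqP => [/eq0_normc //|->]; rewrite normc0. Qed.

Lemma normc_gt0 z : (0 < normc z) = (z != 0).
Proof. by rewrite lt_def normc_ge0 andbT normc_eq0. Qed.

Lemma normcX z n : normc (z ^+ n) = normc z ^+ n.
Proof. by elim: n => [|n IH]; rewrite ?normc1 // !exprS normcM IH. Qed.

Lemma normcXz z (k : int) : normc (z ^ k) = normc z ^ k.
Proof. by case: k => n; rewrite ?NegzE -?exprnN /= ?normcV normcX. Qed.

Lemma normc_Re z : `|complex.Re z| <= normc z.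
Proof. by rewrite -lecR -normrE normc_ge_Re. Qed.

Lemma normc_Im z : `|complex.Im z| <= normc z.
Proof.
case: z => a b; rewrite /normc /= -sqrtr_sqr.
by rewrite ler_wsqrtr // lerDr sqr_ge0.
Qed.

Lemma normc_le z : normc z <= `|complex.Re z| + `|complex.Im z|.
Proof.
rewrite [z in X in X <= _]complexE; apply: (le_trans (normc_triangle _ _)).
by rewrite normcM normc_i mul1r !normc_real.
Qed.

Lemma normc_sum (I : Type) (r : seq I) (P : pred I) (F : I -> R[i]) :
  normc (\sum_(i <- r | P i) F i) <= \sum_(i <- r | P i) normc (F i).
Proof.
elim/big_ind2 : _ => [|u a v b ua vb|//]; first by rewrite normc0.
by apply: (le_trans (normc_triangle _ _)); rewrite lerD.
Qed.

(** Convergence in [R[i]^o] is expressed with a complex-valued norm and complex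
    tolerances; real tolerances suffice because every positive complex number
    is real. *)
Lemma cvgC_normcP (T : Type) (F : set_system T) {FF : Filter F}
    (u : T -> R[i]) (l : R[i]) :
  (u x : R[i]^o) @[x --> F] --> (l : R[i]^o) <->
  (forall e, 0 < e -> \forall x \near F, normc (l - u x) < e).
Proof.
split=> [/cvgrPdist_lt ul e e0|ul].
  have /ul : (0 : R[i]) < e%:C by rewrite ltcR.
  by apply: filterS => x; rewrite -ltcR.
apply/cvgrPdist_lt => -[a b]; rewrite ltcE /= => /andP[/eqP -> a0].
have := ul _ a0; apply: filterS => x; rewrite -ltcR => h.
exact: h.
Qed.

Lemma cvgC_Re (T : Type) (F : set_system T) {FF : Filter F}
    (u : T -> R[i]) (l : R[i]) : (u x : R[i]^o) @[x --> F] --> (l : R[i]^o) ->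
  complex.Re (u x) @[x --> F] --> complex.Re l.
Proof.
move=> /cvgC_normcP ul; apply/cvgrPdist_lt => e /ul.
apply: filterS => x; apply: le_lt_trans.
by apply: le_trans (normc_Re _); case: l {ul} => a b; case: (u x).
Qed.

Lemma cvgC_Im (T : Type) (F : set_system T) {FF : Filter F}
    (u : T -> R[i]) (l : R[i]) : (u x : R[i]^o) @[x --> F] --> (l : R[i]^o) ->
  complex.Im (u x) @[x --> F] --> complex.Im l.
Proof.
move=> /cvgC_normcP ul; apply/cvgrPdist_lt => e /ul.
apply: filterS => x; apply: le_lt_trans.
by apply: le_trans (normc_Im _); case: l {ul} => a b; case: (u x).
Qed.

Lemma cvgC_Re_Im (T : Type) (F : set_system T) {FF : Filter F}
    (u : T -> R[i]) (l : R[i]) :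
  complex.Re (u x) @[x --> F] --> complex.Re l ->
  complex.Im (u x) @[x --> F] --> complex.Im l ->
  (u x : R[i]^o) @[x --> F] --> (l : R[i]^o).
Proof.
move=> /cvgrPdist_lt ua /cvgrPdist_lt ub; apply/cvgC_normcP => e e0.
have e2 : 0 < e / 2 by rewrite divr_gt0.
near=> x; apply: (le_lt_trans (normc_le _)); rewrite [e]splitr.
rewrite !raddfB; apply: ltrD; near: x; [exact: ua|exact: ub].
Unshelve. all: by end_near.
Qed.

Lemma continuous_normc : continuous (@normc R : R[i]^o -> R).
Proof.
move=> z; apply/(cvgrPdist_lt (F := nbhs (z : R[i]^o))) => e e0; near=> w.
have : normc (z - w) < e.
  near: w; have /cvgC_normcP : (w : R[i]^o) @[w --> (z : R[i]^o)] --> (z : R[i]^o).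
    exact: cvg_id.
  exact.
apply: le_lt_trans; rewrite ler_norml; apply/andP; split.
  rewrite lerBrDl lerBlDr -[w in X in X <= _](subrK z) normc_distC.
  rewrite addrC; exact: normc_triangle.
by rewrite lerBlDr -[z in X in X <= _](subrK w) normc_triangle.
Unshelve. all: by end_near.
Qed.

End ComplexModulus.

Section ComplexExponential.
Variable R : realType.
Implicit Types (z w : R[i]) (x y : R).

Lemma CexpD z w : Cexp (z + w) = Cexp z * Cexp w.
Proof.
case: z w => [a b] [c d]; rewrite /Cexp /= expRD cosD sinD.
by simpc; congr (_ +i* _); ring.
Qed.

Lemma Cexp0 : Cexp (0 : R[i]) = 1.
Proof. by rewrite /Cexp /= expR0 cos0 sin0 mul1r. Qed.

Lemma normc_Cexp z : normc (Cexp z) = expR (complex.Re z).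
Proof.
rewrite /Cexp normcM normc_real ger0_norm ?expR_ge0 //.
by rewrite /normc /= cos2Dsin2 sqrtr1 mulr1.
Qed.

Lemma normc_Cexp_le z : normc (Cexp z) <= expR (normc z).
Proof.
by rewrite normc_Cexp ler_expR; apply: le_trans (normc_Re z); exact: ler_norm.
Qed.

Lemma Cexp_neq0 z : Cexp z != 0.
Proof. by rewrite -normc_gt0 normc_Cexp expR_gt0. Qed.

Lemma CexpN z : Cexp (- z) = (Cexp z)^-1.
Proof.
by apply: (mulfI (Cexp_neq0 z)); rewrite -CexpD subrr Cexp0 divff ?Cexp_neq0.
Qed.

Lemma circle_point_expR x (t : R) : circle_point (expR x) t = Cexp (x +i* t).
Proof. by []. Qed.

Lemma normc_circle_point (r t : R) : 0 <= r -> normc (circle_point r t) = r.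
Proof.
move=> r0; rewrite /circle_point normcM normc_real ger0_norm //.
by rewrite /normc /= cos2Dsin2 sqrtr1 mulr1.
Qed.

Lemma circle_point_periodic (r : R) :
  circle_point r (2 * pi) = circle_point r 0.
Proof. by rewrite /circle_point mulr_natl cos2pi sin2pi cos0 sin0. Qed.

(** Cleared of denominators, differentiability also holds at [b = a] and can be
    summed over the sides of a small rectangle. *)
Lemma derivable_le (K : numFieldType) (f : K^o -> K^o) (a l e : K) :
  is_derive (a : K^o) (1 : K^o) f l -> 0 < e ->
  \forall b \near (a : K^o), `|f b - f a - l * (b - a)| <= e * `|b - a|.
Proof.
move=> [df fl] e0; move: df; rewrite /derivable => /cvg_ex[/= l'].
move=> fl'; have ll' : l' = l.
  by have H := cvg_lim (@norm_hausdorff K K^o) fl'; rewrite -fl -H.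
move: fl'; rewrite {}ll' => /cvgrPdist_lt /(_ _ e0).
rewrite near_withinE => H.
have : \forall b \near (a : K^o), b - a != 0 ->
    `|l - (b - a)^-1 *: (f ((b - a) *: (1 : K^o) + a) - f a)| < e.
  have: (fun b : K^o => b - a) @ (a : K^o) --> (0 : K^o).
    rewrite -[X in _ --> X](@subrr K^o a).
    exact: (@cvgB K K^o K^o (nbhs (a : K^o)) _ id (cst a) a a cvg_id (cvg_cst _)).
  by move=> /(_ _ H).
apply: filterS => b; have [->|ba] := eqVneq b a.
  by rewrite !subrr mulr0 subrr !normr0 mulr0.
rewrite subr_eq0 ba => /(_ isT) /ltW.
rewrite [_ *: (1 : K^o)]mulr1 subrK => h.
have {}h : `|l - (b - a)^-1 * (f b - f a)| <= e := h.
have nba : 0 < `|b - a| by rewrite normr_gt0 subr_eq0.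
have -> : f b - f a - l * (b - a) =
    - ((b - a) * (l - (b - a)^-1 * (f b - f a))).
  by rewrite [in RHS]mulrBr mulrA divff ?subr_eq0 // mul1r opprB [l * _]mulrC.
by rewrite normrN normrM mulrC ler_wpM2r // ltW.
Qed.

Lemma is_derive_le (K : numFieldType) (f : K^o -> K^o) (a l : K) :
  (forall e, 0 < e ->
    \forall b \near (a : K^o), `|f b - f a - l * (b - a)| <= e * `|b - a|) ->
  derivable f (a : K^o) (1 : K^o).
Proof.
move=> H; apply/cvg_ex; exists l.
apply/(@cvgrPdist_lt K K^o K^o ((0 : K^o)^')) => e e0.
have e2 : 0 < e / 2 by rewrite divr_gt0.
rewrite near_withinE.
have : \forall h \near (0 : K^o),
    `|f (h + a) - f a - l * (h + a - a)| <= e / 2 * `|h + a - a|.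
  have: (fun h : K^o => h + a) @ (0 : K^o) --> (a : K^o).
    rewrite -[X in _ --> X](@add0r K^o a).
    exact: (@cvgD K K^o K^o (nbhs (0 : K^o)) _ id (cst a) 0 a cvg_id (cvg_cst _)).
  by move=> /(_ _ (H _ e2)).
apply: filterS => h /=.
rewrite addrK [_ *: (1 : K^o)]mulr1 => hh h0.
have nh : 0 < `|h| by rewrite normr_gt0.
suff : `|l - h^-1 * (f (h + a) - f a)| < e by [].
have -> : l - h^-1 * (f (h + a) - f a) = - (h^-1 * (f (h + a) - f a - l * h)).
  by rewrite [in RHS]mulrBr opprB [l * h]mulrC mulrA mulVf // mul1r.
rewrite normrN normrM normfV mulrC ltr_pdivrMr //.
apply: (le_lt_trans hh); rewrite ltr_pM2r // ltr_pdivrMr //.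
by rewrite mulr_natr mulr2n ltrDl.
Qed.

Lemma is_derive0_near (f : R -> R) (l e : R) :
  is_derive (0 : R) 1 f l -> 0 < e ->
  exists2 d : R, 0 < d &
    forall x, `|x| < d -> `|f x - f 0 - l * x| <= e * `|x|.
Proof.
move=> fl e0; have /nbhs_ballP[d /= d0 H] := @derivable_le R f 0 l e fl e0.
exists d => // x xd; have := H x; rewrite /ball /= subr0 => -> //.
by rewrite sub0r normrN.
Qed.

(** By the functional equation it is enough to expand at 0, where the real
    derivatives of [expR], [cos] and [sin] are combined. *)
Lemma derivable_Cexp z : derivable (@Cexp R : R[i]^o -> R[i]^o) z 1.
Proof.
apply: (@is_derive_le _ _ _ (Cexp z)) => -[e ?].
rewrite ltcE /= => /andP[/eqP -> e0]; rewrite -[_ +i* 0]/(e%:C).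
(* The error term of [Cexp] is bounded by 8 m times the step, see [t1]-[t4]. *)
have [m [m0 m1 me]] : exists m : R, [/\ 0 < m, m <= 1 &
    m <= e / (8 * expR (complex.Re z))].
  exists (Num.min 1 (e / (8 * expR (complex.Re z)))); split.
  - by rewrite lt_min ltr01 divr_gt0 // mulr_gt0 // expR_gt0.
  - by rewrite ge_min lexx.
  - by rewrite ge_min lexx orbT.
have [d1 d10 He] := is_derive0_near (is_derive_expR 0) m0.
have [d2 d20 Hc] := is_derive0_near (is_derive_cos 0) m0.
have [d3 d30 Hs] := is_derive0_near (is_derive_sin 0) m0.
pose d := Num.min (Num.min d1 d2) (Num.min d3 m).
have d0 : 0 < d by rewrite !lt_min d10 d20 d30 m0.
have : (fun w : R[i]^o => w) @ (z : R[i]^o) --> (z : R[i]^o) by exact: cvg_id.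
move=> /cvgC_normcP /(_ _ d0); apply: filterS => w.
rewrite !normrE -rmorphM /= lecR normc_distC; set h := w - z => hd.
have -> : Cexp w - Cexp z - Cexp z * h = Cexp z * (Cexp h - 1 - h).
  by rewrite -[w](subrK z) -/h addrC CexpD; ring.
rewrite normcM normc_Cexp.
suff: normc (Cexp h - 1 - h) <= 8 * m * normc h.
  move=> H; apply: (le_trans (ler_wpM2l (expR_ge0 _) H)).
  have -> : expR (complex.Re z) * (8 * m * normc h) =
      m * (8 * expR (complex.Re z)) * normc h by ring.
  by rewrite ler_wpM2r ?normc_ge0 // -ler_pdivlMr // mulr_gt0 ?expR_gt0.
case: h hd => x y hd; have hx : `|x| <= _ := normc_Re (x +i* y).
have hy : `|y| <= _ := normc_Im (x +i* y).
rewrite -[Cexp _]/((expR x)%:C * (cos y +i* sin y)).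
move: hd hx hy; set nh := normc (x +i* y) => hd hx hy.
move: hd; rewrite /d !lt_min => /andP[/andP[h1 h2] /andP[h3 h4]].
have {}He := He x (le_lt_trans hx h1); have {}Hc := Hc y (le_lt_trans hy h2).
have {}Hs := Hs y (le_lt_trans hy h3).
move: He Hc Hs; rewrite expR0 cos0 sin0 oppr0 mul0r !subr0 ?addr0 !mul1r => He Hc Hs.
have nm x' : `|x'| <= nh -> m * `|x'| <= m * nh by move=> ?; rewrite ler_pM2l.
have {}He := le_trans He (nm _ hx); have {}Hc := le_trans Hc (nm _ hy).
have {}Hs := le_trans Hs (nm _ hy).
have cy : `|cos y| <= 1 by rewrite ler_norml cos_geN1 cos_le1.
have mnh : m * nh <= nh by rewrite ler_piMl // normc_ge0.
have nh1 : nh <= 1 by apply: le_trans m1; exact: ltW.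
have -> : (expR x)%:C * (cos y +i* sin y) - 1 - (x +i* y) =
    (expR x * cos y - 1 - x) +i* (expR x * sin y - y).
  by rewrite -[1]/(1 +i* 0); simpc.
apply: (le_trans (normc_le _)) => /=.
have -> : expR x * cos y - 1 - x = (expR x - 1 - x) * cos y + (1 + x) * (cos y - 1).
  by ring.
have -> : expR x * sin y - y = (expR x - 1) * sin y + (sin y - y) by ring.
have t1 : `|(expR x - 1 - x) * cos y| <= m * nh.
  by rewrite normrM -[m * nh]mulr1 ler_pM.
have t2 : `|(1 + x) * (cos y - 1)| <= 2 * (m * nh).
  rewrite normrM ler_pM //; apply: (le_trans (ler_normD _ _)).
  by rewrite normr1 lerD2l (le_trans hx).
have t3 : `|(expR x - 1) * sin y| <= 4 * (m * nh).
  have -> : 4 * (m * nh) = (2 * m) * (2 * nh) by ring.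
  rewrite normrM ler_pM //.
    rewrite -[expR x - 1](subrK x); apply: (le_trans (ler_normD _ _)).
    suff: m * nh <= m by lra.
    by rewrite ler_piMr // ltW.
  rewrite -[sin y](subrK y); apply: (le_trans (ler_normD _ _)).
  lra.
have t4 := ler_normD ((expR x - 1 - x) * cos y) ((1 + x) * (cos y - 1)).
have t5 := ler_normD ((expR x - 1) * sin y) (sin y - y).
lra.
Qed.

End ComplexExponential.

(** * Integrals of complex-valued functions on a segment *)

Section ComplexIntegral.
Variable R : realType.
Implicit Types (a b c d : R) (g h : R -> R[i]).

Definition Cintegrable a b g :=
  (@lebesgue_measure R).-integrable `[a, b] (EFin \o (fun t => complex.Re (g t)))
  /\ (@lebesgue_measure R).-integrable `[a, b]
       (EFin \o (fun t => complex.Im (g t))).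

Lemma measurable_segment a b :
  measurable ([set` `[a, b]] : set (measurableTypeR R)).
Proof. exact: measurable_itv. Qed.

Lemma Cintegrable_continuous a b g :
  (forall t, a <= t <= b -> {for t, continuous (g : R -> R[i]^o)}) ->
  Cintegrable a b g.
Proof.
move=> gc; split; apply: continuous_compact_integrable; try exact: segment_compact.
  apply: continuous_in_subspaceT => t /set_mem; rewrite /= in_itv => /= /gc ct.
  exact: (@cvgC_Re R R (nbhs t) _ g (g t) ct).
apply: continuous_in_subspaceT => t /set_mem; rewrite /= in_itv => /= /gc ct.
exact: (@cvgC_Im R R (nbhs t) _ g (g t) ct).
Qed.

Lemma Cintegrable_cst a b (z : R[i]) : Cintegrable a b (fun=> z).
Proof. by apply: Cintegrable_continuous => t _; exact: cst_continuous. Qed.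

Lemma Cintegrable_sub a b c d g : a <= c -> d <= b ->
  Cintegrable a b g -> Cintegrable c d g.
Proof.
move=> ac db [g1 g2]; split.
  apply: integrableS g1 => //= t; rewrite /= !in_itv /= => /andP[ct td].
  by rewrite (le_trans ac) //= (le_trans td).
apply: integrableS g2 => //= t; rewrite /= !in_itv /= => /andP[ct td].
by rewrite (le_trans ac) //= (le_trans td).
Qed.

Lemma eq_Cintegral a b g h : (forall t, a <= t <= b -> g t = h t) ->
  Cintegral a b g = Cintegral a b h.
Proof.
move=> gh; rewrite /Cintegral; congr (_ +i* _); apply: eq_Rintegral => t.
  by move=> /set_mem; rewrite /= in_itv => /= /gh ->.
by move=> /set_mem; rewrite /= in_itv => /= /gh ->.
Qed.

Lemma CintegrableD a b g h : Cintegrable a b g -> Cintegrable a b h ->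
  Cintegrable a b (fun t => g t + h t).
Proof.
move=> [g1 g2] [h1 h2]; split.
  have := integrableD (measurable_segment a b) g1 h1; apply: eq_integrable => // t _.
  by rewrite /= raddfD.
have := integrableD (measurable_segment a b) g2 h2; apply: eq_integrable => // t _.
by rewrite /= raddfD.
Qed.

Lemma CintegralD a b g h : Cintegrable a b g -> Cintegrable a b h ->
  Cintegral a b (fun t => g t + h t) = Cintegral a b g + Cintegral a b h.
Proof.
move=> [g1 g2] [h1 h2]; rewrite /Cintegral.
under eq_Rintegral do rewrite raddfD.
under [X in _ +i* X]eq_Rintegral do rewrite raddfD.
by rewrite !RintegralD //; simpc.
Qed.

Lemma integrable_lin2 a b (f1 f2 : R -> R) (x y : R) :
  (@lebesgue_measure R).-integrable `[a, b] (EFin \o f1) ->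
  (@lebesgue_measure R).-integrable `[a, b] (EFin \o f2) ->
  (@lebesgue_measure R).-integrable `[a, b]
     (EFin \o (fun t => x * f1 t + y * f2 t)).
Proof.
move=> i1 i2; have m := @measurable_segment a b.
exact: (integrableD m (integrableZl m x i1) (integrableZl m y i2)).
Qed.

Lemma Rintegral_lin2 a b (f1 f2 : R -> R) (x y : R) :
  (@lebesgue_measure R).-integrable `[a, b] (EFin \o f1) ->
  (@lebesgue_measure R).-integrable `[a, b] (EFin \o f2) ->
  \int[@lebesgue_measure R]_(t in `[a, b]) (x * f1 t + y * f2 t) =
  x * \int[@lebesgue_measure R]_(t in `[a, b]) f1 t +
  y * \int[@lebesgue_measure R]_(t in `[a, b]) f2 t.
Proof.
move=> i1 i2; have m := @measurable_segment a b.
have j1 := integrableZl m x i1; have j2 := integrableZl m y i2.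
by rewrite RintegralD // !RintegralZl.
Qed.

Lemma CintegrableZ a b (z : R[i]) g : Cintegrable a b g ->
  Cintegrable a b (fun t => z * g t).
Proof.
case: z => x y [g1 g2]; split.
  have := integrable_lin2 x (- y) g1 g2; apply: eq_integrable => // t _ /=.
  by case: (g t) => u v /=; rewrite mulNr.
have := integrable_lin2 x y g2 g1; apply: eq_integrable => // t _ /=.
by case: (g t) => u v.
Qed.

Lemma CintegralZ a b (z : R[i]) g : Cintegrable a b g ->
  Cintegral a b (fun t => z * g t) = z * Cintegral a b g.
Proof.
case: z => x y [g1 g2]; rewrite /Cintegral.
under eq_Rintegral => t _.
  rewrite (_ : complex.Re _ = x * complex.Re (g t) + (- y) * complex.Im (g t)).
    over.
  by case: (g t) => u v /=; rewrite mulNr.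
under [X in _ +i* X]eq_Rintegral => t _.
  rewrite (_ : complex.Im _ = x * complex.Im (g t) + y * complex.Re (g t)).
    over.
  by case: (g t) => u v /=.
by rewrite !Rintegral_lin2 // mulNr; simpc.
Qed.

Lemma CintegralB a b g h : Cintegrable a b g -> Cintegrable a b h ->
  Cintegral a b (fun t => g t - h t) = Cintegral a b g - Cintegral a b h.
Proof.
move=> gi hi; have hN := CintegrableZ (-1) hi.
rewrite -[in RHS]mulN1r -CintegralZ // -CintegralD //.
by apply: eq_Cintegral => t _; rewrite mulN1r.
Qed.

Lemma CintegrableB a b g h : Cintegrable a b g -> Cintegrable a b h ->
  Cintegrable a b (fun t => g t - h t).
Proof.
move=> gi hi; have := CintegrableD gi (CintegrableZ (-1) hi).
by congr Cintegrable; apply/funext => t; rewrite mulN1r.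
Qed.

Lemma fine_lebesgue_itv a b : a <= b -> fine ((@lebesgue_measure R) `[a, b]) = b - a.
Proof.
move=> ab; rewrite lebesgue_measure_itv /= lte_fin.
by case: ltgtP ab => // -> _; rewrite subrr.
Qed.

Lemma Cintegral_cst a b (z : R[i]) : a <= b ->
  Cintegral a b (fun=> z) = (b - a)%:C * z.
Proof.
move=> ab; rewrite /Cintegral !Rintegral_cst // fine_lebesgue_itv //.
by case: z => x y /=; simpc; congr (_ +i* _); rewrite mulrC.
Qed.

Lemma normr_Rintegral_le a b M (f : R -> R) : a <= b ->
  (@lebesgue_measure R).-integrable `[a, b] (EFin \o f) ->
  (forall t, a <= t <= b -> `|f t| <= M) ->
  `|\int[@lebesgue_measure R]_(t in `[a, b]) f t| <= M * (b - a).
Proof.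
move=> ab fi fM; have m := @measurable_segment a b.
apply: (le_trans (le_normr_Rintegral m fi)).
rewrite -(fine_lebesgue_itv ab) -Rintegral_cst //.
have [Mi _] := Cintegrable_cst a b M%:C.
apply: le_Rintegral => //; first exact: (integrable_abse fi).
Qed.

(** The factor 2 comes from estimating the real and imaginary parts separately,
    which reduces the inequality to real integrals. *)
Lemma normc_Cintegral_le a b M g : a <= b -> Cintegrable a b g ->
  (forall t, a <= t <= b -> normc (g t) <= M) ->
  normc (Cintegral a b g) <= 2 * M * (b - a).
Proof.
move=> ab [g1 g2] gM; apply: (le_trans (normc_le _)) => /=.
have -> : 2 * M * (b - a) = M * (b - a) + M * (b - a) by ring.
apply: lerD; apply: normr_Rintegral_le => // t /gM; apply: le_trans.
  exact: normc_Re.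
exact: normc_Im.
Qed.

Lemma Cintegral_split a c b g : a <= c -> c <= b -> Cintegrable a b g ->
  Cintegral a b g = Cintegral a c g + Cintegral c b g.
Proof.
move=> ac cb gi; have [g1 g2] := gi.
have [k1 k2] := Cintegrable_sub ac (lexx b) gi.
have aux (f : R -> R) : (@lebesgue_measure R).-integrable `[a, b] (EFin \o f) ->
    (@lebesgue_measure R).-integrable `[c, b] (EFin \o f) ->
    \int[@lebesgue_measure R]_(t in `[a, b]) f t =
    \int[@lebesgue_measure R]_(t in `[a, c]) f t +
    \int[@lebesgue_measure R]_(t in `[c, b]) f t.
  move=> fi fi'; apply/eqP; rewrite addrC -subr_eq; apply/eqP.
  rewrite Rintegral_itvB ?bnd_simp //.
  rewrite Rintegral_itv_obnd_cbnd //.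
  apply: integrableS fi' => // t; rewrite /= !in_itv /= => /andP[/ltW -> ->] //.
by rewrite /Cintegral (aux _ g1 k1) (aux _ g2 k2); simpc.
Qed.

End ComplexIntegral.

(** * The Cauchy-Goursat theorem on a rectangle *)

Section Goursat.
Variable R : realType.

(** Nested closed intervals, in the form in which bisection produces them. *)
Lemma nested_halves (u : nat -> R) (l : R) : 0 <= l ->
  (forall n, u n <= u n.+1) ->
  (forall n, u n.+1 + l / 2 ^+ n.+1 <= u n + l / 2 ^+ n) ->
  exists x, forall n, u n <= x <= u n + l / 2 ^+ n.
Proof.
move=> l0 uS lS.
have pos n : 0 <= l / 2 ^+ n by rewrite divr_ge0 // exprn_ge0.
have mono n k : u n <= u (n + k)%N /\
    u (n + k)%N + l / 2 ^+ (n + k)%N <= u n + l / 2 ^+ n.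
  elim: k => [|k [IH1 IH2]]; first by rewrite addn0.
  by rewrite addnS; split; [exact: le_trans (uS _)|exact: le_trans (lS _) _].
have ub n k : u k <= u n + l / 2 ^+ n.
  have [nk|/ltnW kn] := leqP n k.
    have [_] := mono n (k - n)%N; rewrite subnKC //; apply: le_trans.
    by rewrite lerDl.
  have [H _] := mono k (n - k)%N; move: H; rewrite subnKC // => H.
  by apply: (le_trans H); rewrite lerDl.
exists (sup (range u)) => n; apply/andP; split.
  apply: ub_le_sup; last by exists n.
  by exists (u 0%N + l / 2 ^+ 0) => _ [k _ <-].
by apply: ge_sup => [|_ [k _ <-]]; [exists (u 0%N), 0%N|exact: ub].
Qed.

Lemma half_pow_small (S d : R) : 0 < d -> exists n, S / 2 ^+ n < d.
Proof.
move=> d0; exists (Num.bound (S / d)).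
rewrite ltr_pdivrMr ?exprn_gt0 // mulrC -ltr_pdivrMr //.
have [Sd|Sd] := ltP (S / d) 0; first by rewrite (lt_le_trans Sd) // exprn_ge0.
apply: (lt_trans (archi_boundP Sd)).
by rewrite -natrX ltr_nat ltn_expl.
Qed.

Lemma lt_sum4 (w x y z t : R) : 4 * x < w -> 4 * y < w -> 4 * z < w ->
  4 * t < w -> x + y + (z + t) < w.
Proof. lra. Qed.

Variable h : R -> R -> R[i].

(** The integral of [h (x, t) d(x + it)] over the boundary of
    [[a, b] x [c, d]], with opposite sides paired. *)
Definition boundary_integral (a b c d : R) : R[i] :=
  'i%C * (Cintegral c d (h b) - Cintegral c d (h a)) -
  (Cintegral a b (h ^~ d) - Cintegral a b (h ^~ c)).

Variables a0 b0 c0 d0 : R.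
Hypotheses (ab0 : a0 <= b0) (cd0 : c0 <= d0).
Hypothesis hv : forall x, a0 <= x <= b0 -> Cintegrable c0 d0 (h x).
Hypothesis hh : forall t, c0 <= t <= d0 -> Cintegrable a0 b0 (h ^~ t).

(** Pairing opposite sides makes an affine function of [x + it] cancel
    pointwise, so only the deviation [M] from an affine function matters. *)
Lemma normc_boundary_integral_le (a b c d x t M : R) (L : R[i]) :
  a0 <= a -> a <= b -> b <= b0 -> c0 <= c -> c <= d -> d <= d0 ->
  (forall x' t', a <= x' <= b -> c <= t' <= d ->
     normc (h x' t' - h x t - L * ((x' - x) +i* (t' - t))) <= M) ->
  normc (boundary_integral a b c d) <= 4 * M * ((b - a) + (d - c)).
Proof.
move=> a0a ab bb0 c0c cd dd0 HM.
have aI : a <= a <= b by rewrite lexx ab.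
have bI : a <= b <= b by rewrite lexx ab.
have cI : c <= c <= d by rewrite lexx cd.
have dI : c <= d <= d by rewrite lexx cd.
have iv x' : a <= x' <= b -> Cintegrable c d (h x').
  move=> /andP[ax xb]; apply: (Cintegrable_sub c0c dd0); apply: hv.
  by rewrite (le_trans a0a) // (le_trans xb).
have ih t' : c <= t' <= d -> Cintegrable a b (h ^~ t').
  move=> /andP[ct td]; apply: (Cintegrable_sub a0a bb0); apply: hh.
  by rewrite (le_trans c0c) // (le_trans td).
have cst p q (z : R[i]) := Cintegrable_cst p q z.
have -> : boundary_integral a b c d =
   'i%C * Cintegral c d (fun s => h b s - h a s - L * (b - a)%:C) -
   Cintegral a b (fun y => h y d - h y c - L * ('i%C * (d - c)%:C)).
  rewrite !CintegralB ?Cintegral_cst //; try by apply: CintegrableB; auto.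
  all: try by auto.
  by rewrite /boundary_integral; ring.
have dev u v u' v' : a <= u <= b -> c <= v <= d -> a <= u' <= b ->
    c <= v' <= d -> normc (h u v - h u' v' - L * ((u - u') +i* (v - v'))) <= M + M.
  move=> hu hvv hu' hv'.
  have -> : h u v - h u' v' - L * ((u - u') +i* (v - v')) =
     (h u v - h x t - L * ((u - x) +i* (v - t))) -
     (h u' v' - h x t - L * ((u' - x) +i* (v' - t))).
    have -> : (u - u') +i* (v - v') =
        ((u - x) +i* (v - t)) - ((u' - x) +i* (v' - t)) :> R[i].
      by simpc; congr (_ +i* _); ring.
    by ring.
  by apply: (le_trans (normc_sub _ _)); apply: lerD; exact: HM.
have e1 : normc (Cintegral c d (fun s => h b s - h a s - L * (b - a)%:C)) <=
    2 * (M + M) * (d - c).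
  apply: normc_Cintegral_le => // [|s hs].
    by apply: CintegrableB => //; apply: CintegrableB; auto.
  by have := dev b s a s bI hs aI hs; rewrite subrr.
have e2 : normc (Cintegral a b
      (fun y => h y d - h y c - L * ('i%C * (d - c)%:C))) <=
    2 * (M + M) * (b - a).
  apply: normc_Cintegral_le => // [|y hy].
    by apply: CintegrableB => //; apply: CintegrableB; auto.
  have := dev y d y c hy dI hy cI; rewrite subrr.
  by rewrite (_ : 0 +i* (d - c) = 'i%C * (d - c)%:C) //; simpc.
apply: (le_trans (normc_sub _ _)); rewrite normcM normc_i mul1r.
by lra.
Qed.

(** Quadratic smallness in the size of the rectangle is what makes the
    subdivision argument close up. *)
Lemma boundary_integral_near_le (a c l m x t e dl : R) (L : R[i]) :
  0 <= l -> 0 <= m -> 0 < e -> l + m < dl ->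
  a0 <= a -> a + l <= b0 -> c0 <= c -> c + m <= d0 ->
  a <= x -> x <= a + l -> c <= t -> t <= c + m ->
  (forall x' t', a0 <= x' <= b0 -> c0 <= t' <= d0 ->
      `|x' - x| < dl -> `|t' - t| < dl ->
      normc (h x' t' - h x t - L * ((x' - x) +i* (t' - t)))
      <= e * (`|x' - x| + `|t' - t|)) ->
  normc (boundary_integral a (a + l) c (c + m)) <= 4 * (e * (l + m)) * (l + m).
Proof.
move=> l0 m0 e0 lmd a0a ab c0c cd ax xa ct tc Hd.
have -> : 4 * (e * (l + m)) * (l + m) =
    4 * (e * (l + m)) * ((a + l - a) + (c + m - c)) by ring.
apply: (@normc_boundary_integral_le _ _ _ _ x t _ L) => //; rewrite ?lerDl //.
move=> x' t' /andP[k1 k2] /andP[k3 k4].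
have n1 : `|x' - x| <= l.
  by rewrite ler_norml; apply/andP; split; clear Hd hv hh; lra.
have n2 : `|t' - t| <= m.
  by rewrite ler_norml; apply/andP; split; clear Hd hv hh; lra.
have n3 : l < dl by apply: le_lt_trans lmd; rewrite lerDl.
have n4 : m < dl by apply: le_lt_trans lmd; rewrite lerDr.
have x'I : a0 <= x' <= b0 by rewrite (le_trans a0a k1) (le_trans k2 ab).
have t'I : c0 <= t' <= d0 by rewrite (le_trans c0c k3) (le_trans k4 cd).
apply: (le_trans (Hd x' t' x'I t'I (le_lt_trans n1 n3) (le_lt_trans n2 n4))).
by rewrite ler_pM2l // lerD.
Qed.

Lemma boundary_integral_splitx (a e b c d : R) :
  a0 <= a -> a <= e -> e <= b -> b <= b0 -> c0 <= c -> c <= d -> d <= d0 ->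
  boundary_integral a b c d = boundary_integral a e c d + boundary_integral e b c d.
Proof.
move=> a0a ae eb bb0 c0c cd dd0; rewrite /boundary_integral.
have ih t' : c <= t' <= d -> Cintegrable a b (h ^~ t').
  move=> /andP[ct td]; apply: (Cintegrable_sub a0a bb0); apply: hh.
  by rewrite (le_trans c0c) // (le_trans td).
rewrite (Cintegral_split ae eb (ih d _)) ?cd ?lexx //.
by rewrite (Cintegral_split ae eb (ih c _)) ?cd ?lexx //; ring.
Qed.

Lemma boundary_integral_splity (a b c e d : R) :
  a0 <= a -> a <= b -> b <= b0 -> c0 <= c -> c <= e -> e <= d -> d <= d0 ->
  boundary_integral a b c d = boundary_integral a b c e + boundary_integral a b e d.
Proof.
move=> a0a ab bb0 c0c ce ed dd0; rewrite /boundary_integral.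
have iv x' : a <= x' <= b -> Cintegrable c d (h x').
  move=> /andP[ax xb]; apply: (Cintegrable_sub c0c dd0); apply: hv.
  by rewrite (le_trans a0a) // (le_trans xb).
rewrite (Cintegral_split ce ed (iv a _)) ?ab ?lexx //.
by rewrite (Cintegral_split ce ed (iv b _)) ?ab ?lexx //; ring.
Qed.

(** The four quarters have boundary integrals that add up to the whole one, so
    one of them carries at least a quarter of its modulus. *)
Lemma boundary_integral_quarter (a c l m : R) : 0 <= l -> 0 <= m ->
  a0 <= a -> a + (l + l) <= b0 -> c0 <= c -> c + (m + m) <= d0 ->
  exists a' c', [/\ a <= a', a' + l <= a + (l + l), c <= c',
    c' + m <= c + (m + m) &
    normc (boundary_integral a (a + (l + l)) c (c + (m + m))) <=
    4 * normc (boundary_integral a' (a' + l) c' (c' + m))].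
Proof.
move=> l0 m0 a0a al c0c cm.
have sx : boundary_integral a (a + (l + l)) c (c + (m + m)) =
    boundary_integral a (a + l) c (c + (m + m)) +
    boundary_integral (a + l) (a + (l + l)) c (c + (m + m)).
  by apply: boundary_integral_splitx; lra.
have sy1 : boundary_integral a (a + l) c (c + (m + m)) =
    boundary_integral a (a + l) c (c + m) +
    boundary_integral a (a + l) (c + m) (c + (m + m)).
  by apply: boundary_integral_splity; lra.
have sy2 : boundary_integral (a + l) (a + (l + l)) c (c + (m + m)) =
    boundary_integral (a + l) (a + (l + l)) c (c + m) +
    boundary_integral (a + l) (a + (l + l)) (c + m) (c + (m + m)).
  by apply: boundary_integral_splity; lra.
have split4 := sx; rewrite sy1 sy2 in split4.
have al1 : a <= a + l by lra.
have al2 : a + l <= a + (l + l) by lra.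
have cm1 : c <= c + m by lra.
have cm2 : c + m <= c + (m + m) by lra.
clear sx sy1 sy2; move: split4; set W := boundary_integral a _ c _.
set q1 := boundary_integral a _ c (c + m).
set q2 := boundary_integral a _ (c + m) _.
set q3 := boundary_integral _ _ c (c + m).
set q4 := boundary_integral _ _ (c + m) _ => split4.
have W4 : normc W <= normc q1 + normc q2 + (normc q3 + normc q4).
  rewrite split4; apply: (le_trans (normc_triangle _ _)).
  by rewrite lerD ?normc_triangle.
have [h1|h1] := leP (normc W) (4 * normc q1); first by exists a, c.
have [h2|h2] := leP (normc W) (4 * normc q2).
  by exists a, (c + m); split; rewrite -?[c + m + m]addrA.
have [h3|h3] := leP (normc W) (4 * normc q3).
  by exists (a + l), c; split; rewrite -?[a + l + l]addrA.
have [h4|h4] := leP (normc W) (4 * normc q4).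
  exists (a + l), (c + m).
  by split; rewrite -?[a + l + l]addrA -?[c + m + m]addrA.
by have := lt_sum4 h1 h2 h3 h4; rewrite ltNge W4.
Qed.

Hypothesis hd : forall x t, a0 <= x <= b0 -> c0 <= t <= d0 ->
  exists L : R[i], forall e, 0 < e -> exists2 dl, 0 < dl &
    forall x' t', a0 <= x' <= b0 -> c0 <= t' <= d0 ->
      `|x' - x| < dl -> `|t' - t| < dl ->
      normc (h x' t' - h x t - L * ((x' - x) +i* (t' - t)))
      <= e * (`|x' - x| + `|t' - t|).

(** Cauchy-Goursat on a rectangle. Complex differentiability alone, without
    continuity of the derivative, suffices: repeatedly keep a quarter carrying
    at least a quarter of the boundary integral, and compare the resulting lower
    bound with differentiability at the limit point. *)
Theorem Goursat_rectangle : boundary_integral a0 b0 c0 d0 = 0.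
Proof.
pose l := b0 - a0; pose m := d0 - c0.
have l0 : 0 <= l by rewrite subr_ge0.
have m0 : 0 <= m by rewrite subr_ge0.
pose ln n : R := l / 2 ^+ n; pose mn n : R := m / 2 ^+ n.
have p2 n : (0 : R) < 2 ^+ n by rewrite exprn_gt0.
have ln0 n : 0 <= ln n by rewrite divr_ge0 // ltW.
have mn0 n : 0 <= mn n by rewrite divr_ge0 // ltW.
have half (k : R) n : k / 2 ^+ n = k / 2 ^+ n.+1 + k / 2 ^+ n.+1.
  by rewrite exprS invfM; field; rewrite gt_eqF.
pose W n (p : R * R) :=
  boundary_integral p.1 (p.1 + ln n) p.2 (p.2 + mn n).
pose dom n (p : R * R) := [/\ a0 <= p.1, p.1 + ln n <= b0, c0 <= p.2 &
  p.2 + mn n <= d0].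
have step (np : nat * (R * R)) : exists q : R * R, dom np.1 np.2 ->
  [/\ np.2.1 <= q.1, q.1 + ln np.1.+1 <= np.2.1 + ln np.1, np.2.2 <= q.2,
   q.2 + mn np.1.+1 <= np.2.2 + mn np.1 &
   normc (W np.1 np.2) <= 4 * normc (W np.1.+1 q)].
  case: np => n [a c] /=.
  have [[/= h1 h2 h3 h4]|nd] := pselect (dom n (a, c)); last by exists (a, c).
  have El : ln n = ln n.+1 + ln n.+1 by exact: half.
  have Em : mn n = mn n.+1 + mn n.+1 by exact: half.
  rewrite El in h2; rewrite Em in h4.
  have [a' [c' [H1 H2 H3 H4 H5]]] := boundary_integral_quarter
     (ln0 n.+1) (mn0 n.+1) h1 h2 h3 h4.
  by exists (a', c') => _; rewrite /W /= El Em.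
have [f fP] := choice step.
pose s := fix s n := if n is k.+1 then f (k, s k) else (a0, c0).
have El0 : a0 + ln 0%N = b0 by rewrite /ln expr0 divr1 /l addrC subrK.
have Em0 : c0 + mn 0%N = d0 by rewrite /mn expr0 divr1 /m addrC subrK.
have sdom n : dom n (s n).
  elim: n => [|n IH]; first by split; rewrite /= ?El0 ?Em0.
  have [h1 h2 h3 h4] := IH.
  have [H1 H2 H3 H4 _] := fP (n, s n) IH; split.
  - exact: le_trans H1.
  - exact: le_trans H2 _.
  - exact: le_trans H3.
  - exact: le_trans H4 _.
have sW n : normc (W 0%N (s 0%N)) <= 4 ^+ n * normc (W n (s n)).
  elim: n => [|n IH]; first by rewrite expr0 mul1r.
  have [_ _ _ _ H] := fP (n, s n) (sdom n).
  apply: (le_trans IH); rewrite exprSr -mulrA ler_pM2l ?exprn_gt0 //.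
have [x xP] : exists x, forall n, (s n).1 <= x <= (s n).1 + ln n.
  by apply: nested_halves => // n; have [] := fP (n, s n) (sdom n).
have [t tP] : exists t, forall n, (s n).2 <= t <= (s n).2 + mn n.
  by apply: nested_halves => // n; have [] := fP (n, s n) (sdom n).
have W0 : W 0%N (s 0%N) = boundary_integral a0 b0 c0 d0.
  by rewrite /W /= El0 Em0.
have xI : a0 <= x <= b0.
  have := xP 0%N; have [h1 h2 _ _] := sdom 0%N => /andP[h3 h4].
  by rewrite (le_trans h1) //= (le_trans h4).
have tI : c0 <= t <= d0.
  have := tP 0%N; have [_ _ h1 h2] := sdom 0%N => /andP[h3 h4].
  by rewrite (le_trans h1) //= (le_trans h4).
have [L HL] := hd xI tI.
pose w := normc (boundary_integral a0 b0 c0 d0).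
have w0 : 0 <= w by exact: normc_ge0.
have small e : 0 < e -> w <= 4 * (l + m) ^+ 2 * e.
  move=> e0; have [dl dl0 Hdl] := HL _ e0.
  have [n nd] := half_pow_small (l + m) dl0.
  rewrite mulrDl -/(ln n) -/(mn n) in nd.
  have := sW n; rewrite W0 -/w => /le_trans; apply.
  have [h1 h2 h3 h4] := sdom n; have /andP[h5 h6] := xP n.
  have /andP[h7 h8] := tP n; have lnn := ln0 n; have mnn := mn0 n.
  have H : normc (W n (s n)) <= 4 * (e * (ln n + mn n)) * (ln n + mn n).
    exact: (@boundary_integral_near_le _ _ _ _ x t e dl L).
  apply: (le_trans (ler_wpM2l (exprn_ge0 n _) H)) => //.
  rewrite -mulrDl (_ : (4 : R) = 2 ^+ 2) -?exprM; last by ring.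
  rewrite le_eqVlt; apply/orP; left; apply/eqP.
  have -> : (2 : R) ^+ (2 * n) = (2 ^+ n) ^+ 2 by rewrite mulnC exprM.
  by field; rewrite gt_eqF.
apply/eqP; rewrite -normc_eq0 -/w.
(* [w <= K e] for all [e > 0] with [K = 4 (l + m) ^ 2]; take [e = w / (K + 1)]. *)
have K0 : 0 <= 4 * (l + m) ^+ 2 by rewrite mulr_ge0 // sqr_ge0.
move: w0; rewrite le_eqVlt => /orP[/eqP <- //|wgt].
set K := 4 * _ in small K0.
have K1 : 0 < K + 1 by rewrite ltr_wpDl.
have := small (w / (K + 1)) (divr_gt0 wgt K1).
by rewrite mulrA ler_pdivlMr // mulrDr mulr1 mulrC gerDl leNgt wgt.
Qed.

End Goursat.

(** * Moving a circular contour *)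

Section DerivableField.
Variable K : numFieldType.
Implicit Types f g : K^o -> K^o.

Lemma derivable_continuous1 f (z : K^o) : derivable f z 1 ->
  {for z, continuous f}.
Proof. by move=> /derivable1_diffP /differentiable_continuous. Qed.

Lemma derivable_comp1 f g (z : K^o) : derivable g z 1 ->
  derivable f (g z) 1 -> derivable (f \o g) z 1.
Proof.
move=> /derivable1_diffP dg /derivable1_diffP df; apply/derivable1_diffP.
exact: differentiable_comp.
Qed.

Lemma derivableM1 f g (z : K^o) : derivable f z 1 -> derivable g z 1 ->
  derivable ((fun w => f w * g w) : K^o -> K^o) z 1.
Proof. by move=> df dg; exact: derivableM. Qed.

Lemma derivableV1 f (z : K^o) : f z != 0 -> derivable f z 1 ->
  derivable ((fun w => (f w)^-1) : K^o -> K^o) z 1.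
Proof. by move=> f0 df; exact: derivableV. Qed.

Lemma derivableD1 f g (z : K^o) : derivable f z 1 -> derivable g z 1 ->
  derivable ((fun w => f w + g w) : K^o -> K^o) z 1.
Proof. by move=> df dg; exact: derivableD. Qed.

Lemma derivable_exprz1 (k : int) (z : K^o) : z != 0 ->
  derivable ((fun w => w ^ k) : K^o -> K^o) z 1.
Proof.
have X n (w : K^o) : derivable ((fun w => w ^+ n) : K^o -> K^o) w 1.
  elim: n => [|n IH]; first exact: derivable_cst.
  under eq_fun do rewrite exprS; apply: derivableM1 => //; exact: derivable_id.
move=> z0; case: k => n; first exact: X.
by apply: derivableV1; [exact: (@expf_neq0 K)|exact: X].
Qed.

Lemma derivable_cst1 (c : K) (z : K^o) : derivable ((fun=> c) : K^o -> K^o) z 1.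
Proof. exact: derivable_cst. Qed.

End DerivableField.

Section ContourShift.
Variable R : realType.
Implicit Types (z w : R[i]) (F : R[i] -> R[i]).

Definition holomorphic_at F z := derivable (F : R[i]^o -> R[i]^o) z 1.

Lemma nearC_normc (P : R[i] -> Prop) z : (\forall w \near (z : R[i]^o), P w) ->
  exists2 d : R, 0 < d & forall w, normc (w - z) < d -> P w.
Proof.
move=> /nbhs_ballP[[d ?]]; rewrite /= ltcE /= => /andP[/eqP -> d0 H].
exists d => // w wz; apply: H; rewrite /ball /= normrE.
by rewrite -[d +i* 0]/(d%:C) ltcR normc_distC.
Qed.

Lemma holomorphic_at_continuous F z : holomorphic_at F z ->
  {for z, continuous (F : R[i]^o -> R[i]^o)}.
Proof. exact: (@derivable_continuous1 R[i] F z). Qed.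

Lemma holomorphic_at_comp F G z : holomorphic_at G z ->
  holomorphic_at F (G z) -> holomorphic_at (F \o G) z.
Proof. exact: (@derivable_comp1 R[i] F G z). Qed.

Lemma holomorphic_atM F G z : holomorphic_at F z -> holomorphic_at G z ->
  holomorphic_at (fun w => F w * G w) z.
Proof. exact: (@derivableM1 R[i] F G z). Qed.

Lemma holomorphic_atD F G z : holomorphic_at F z -> holomorphic_at G z ->
  holomorphic_at (fun w => F w + G w) z.
Proof. exact: (@derivableD1 R[i] F G z). Qed.

Lemma holomorphic_at_cst c z : holomorphic_at (fun=> c) z.
Proof. exact: (@derivable_cst1 R[i] c z). Qed.

Lemma holomorphic_at_exprz (k : int) z : z != 0 ->
  holomorphic_at (fun w => w ^ k) z.
Proof. exact: (@derivable_exprz1 R[i] k z). Qed.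

Lemma holomorphic_at_sum (n : nat) (G : nat -> R[i] -> R[i]) z :
  (forall m, holomorphic_at (G m) z) ->
  holomorphic_at (fun w => \sum_(0 <= m < n) G m w) z.
Proof.
move=> dG; elim: n => [|n IH].
  have -> : (fun w => \sum_(0 <= m < 0) G m w) = (fun=> 0).
    by apply/funext => w; rewrite big_nil.
  exact: (@holomorphic_at_cst 0 z).
have -> : (fun w => \sum_(0 <= m < n.+1) G m w) =
    (fun w => \sum_(0 <= m < n) G m w + G n w).
  by apply/funext => w; rewrite big_nat_recr.
exact: (holomorphic_atD IH (dG n)).
Qed.

Lemma continuous_line (x t : R) :
  {for t, continuous ((fun t => x +i* t) : R -> R[i]^o)}.
Proof.
apply: (@cvgC_Re_Im R R (nbhs t) _ (fun t => x +i* t) (x +i* t)) => /=.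
  exact: cvg_cst.
exact: cvg_id.
Qed.

Lemma continuous_hline (x t : R) :
  {for x, continuous ((fun x => x +i* t) : R -> R[i]^o)}.
Proof.
apply: (@cvgC_Re_Im R R (nbhs x) _ (fun x => x +i* t) (x +i* t)) => /=.
  exact: cvg_id.
exact: cvg_cst.
Qed.

(** In the coordinates [z = exp (x + it)] an annulus is a rectangle whose
    horizontal sides carry the same values, so only the two circles contribute
    to the boundary integral. *)
Lemma oint_shift_le F (r1 r2 : R) : 0 < r1 -> r1 <= r2 ->
  (forall z, r1 <= normc z <= r2 -> holomorphic_at F z) ->
  oint r1 F = oint r2 F.
Proof.
move=> r10 r12 dF; have r20 : 0 < r2 by exact: lt_le_trans r12.
pose H w := F (Cexp w) * Cexp w.
have dH x t : ln r1 <= x <= ln r2 -> holomorphic_at H (x +i* t).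
  move=> /andP[x1 x2]; have dE := @derivable_Cexp R (x +i* t).
  suff dFE : holomorphic_at F (Cexp (x +i* t)).
    exact: (holomorphic_atM (holomorphic_at_comp dE dFE) dE).
  apply: dF; rewrite normc_Cexp /=.
  by rewrite -(lnK (r10 : r1 \is Num.pos)) -(lnK (r20 : r2 \is Num.pos)) !ler_expR x1.
pose h x t := H (x +i* t).
have ln12 : ln r1 <= ln r2 by rewrite ler_ln.
have pi2 : (0 : R) <= 2 * pi by rewrite mulr_ge0 // pi_ge0.
have hv x : ln r1 <= x <= ln r2 -> Cintegrable 0 (2 * pi) (h x).
  move=> xI; apply: Cintegrable_continuous => t _.
  apply: (@continuous_comp _ _ _ ((fun t => x +i* t) : R -> R[i]^o) (H : R[i]^o -> R[i]^o)).
    exact: continuous_line.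
  exact: (holomorphic_at_continuous (dH x t xI)).
have hh t : 0 <= t <= 2 * pi -> Cintegrable (ln r1) (ln r2) (h ^~ t).
  move=> _; apply: Cintegrable_continuous => x xI.
  apply: (@continuous_comp _ _ _ ((fun x => x +i* t) : R -> R[i]^o) (H : R[i]^o -> R[i]^o)).
    exact: continuous_hline.
  exact: (holomorphic_at_continuous (dH x t xI)).
have := @Goursat_rectangle R h _ _ _ _ ln12 pi2 hv hh.
have hper x : h x (2 * pi) = h x 0.
  by rewrite /h /H -!circle_point_expR circle_point_periodic.
have -> : boundary_integral h (ln r1) (ln r2) 0 (2 * pi) =
    'i%C * (Cintegral 0 (2 * pi) (h (ln r2)) - Cintegral 0 (2 * pi) (h (ln r1))).
  rewrite /boundary_integral; have -> : h ^~ (2 * pi) = h ^~ 0.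
    by apply/funext => x; exact: hper.
  by rewrite [X in _ - X]subrr subr0.
move=> G; have {}G : Cintegral 0 (2 * pi) (h (ln r2)) = Cintegral 0 (2 * pi) (h (ln r1)).
  apply/eqP; rewrite -subr_eq0; apply/eqP.
  apply: (@mulfI _ ('i%C : R[i])); first by rewrite -normc_eq0 normc_i oner_eq0.
  rewrite mulr0; apply: G => x t xI _.
  have dHx := derivableP (dH x t xI).
  exists ('D_1 (H : R[i]^o -> R[i]^o) (x +i* t)) => e e0.
  have e0' : (0 : R[i]) < e%:C by rewrite ltcR.
  have [d d0 Hd] := nearC_normc (derivable_le dHx e0').
  exists (d / 2); first by rewrite divr_gt0.
  move=> x' t' _ _ xd td.
  have E : (x' +i* t') - (x +i* t) = (x' - x) +i* (t' - t) by [].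
  have nE : normc ((x' +i* t') - (x +i* t)) <= `|x' - x| + `|t' - t|.
    exact: normc_le.
  have := Hd (x' +i* t'); rewrite !normrE -rmorphM lecR E => Hd'.
  apply: (le_trans (Hd' _)).
    by apply: (le_lt_trans nE); rewrite [d]splitr ltrD.
  by rewrite ler_pM2l.
have ointE r : 0 < r -> ln r1 <= ln r <= ln r2 ->
    oint r F = (2 * 'i%C * pi%:C)^-1 * ('i%C * Cintegral 0 (2 * pi) (h (ln r))).
  move=> r0 rI; have hI := hv _ rI; rewrite -(CintegralZ 'i%C hI) /oint.
  congr (_ * _); apply: eq_Cintegral => t _.
  by rewrite /h /H -circle_point_expR (lnK (r0 : r \is Num.pos)); ring.
by rewrite (ointE r1) ?(ointE r2) ?G ?ln12 ?lexx.
Qed.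

Lemma oint_shift F (r1 r2 : R) : 0 < r1 -> 0 < r2 ->
  (forall z, Num.min r1 r2 <= normc z <= Num.max r1 r2 -> holomorphic_at F z) ->
  oint r1 F = oint r2 F.
Proof.
move=> r10 r20; have [r12|/ltW r21] := leP r1 r2 => dF.
  exact: oint_shift_le.
by apply/esym/oint_shift_le.
Qed.

End ContourShift.

(** * Integrals over circles *)

Section CircleIntegral.
Variable R : realType.
Implicit Types (z w : R[i]) (g h : R[i] -> R[i]) (r M : R).

(** Continuity of [g] restricted to a circle, expressed through the
    parametrization that defines [oint]. *)
Definition circle_continuous r g :=
  forall t : R, {for t, continuous ((fun t => g (circle_point r t)) : R -> R[i]^o)}.

Lemma circle_continuous_holomorphic r g : 0 < r ->
  (forall z, normc z = r -> holomorphic_at g z) -> circle_continuous r g.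
Proof.
move=> r0 dg t; pose G := fun w : R[i] => g (Cexp w).
have -> : (fun t => g (circle_point r t)) = (fun t => G (ln r +i* t)).
  apply/funext => s; rewrite /G -circle_point_expR.
  by rewrite (lnK (r0 : r \is Num.pos)).
have dG : holomorphic_at G (ln r +i* t).
  apply: (holomorphic_at_comp (@derivable_Cexp R (ln r +i* t))); apply: dg.
  by rewrite normc_Cexp /= (lnK (r0 : r \is Num.pos)).
apply: (@continuous_comp _ _ _ ((fun t => ln r +i* t) : R -> R[i]^o)
  (G : R[i]^o -> R[i]^o)).
  exact: continuous_line.
exact: (holomorphic_at_continuous dG).
Qed.

Lemma continuousM1 (K : numFieldType) (T : topologicalType) (f g : T -> K^o) t :
  {for t, continuous f} -> {for t, continuous g} ->
  {for t, continuous ((fun x => f x * g x) : T -> K^o)}.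
Proof. by move=> fc gc; exact: (@continuousM K T f g). Qed.

Lemma circle_continuousM r g h : circle_continuous r g -> circle_continuous r h ->
  circle_continuous r (fun z => g z * h z).
Proof. by move=> gc hc t; exact: (@continuousM1 R[i] R _ _ t (gc t) (hc t)). Qed.

Lemma continuousV1 (K : numFieldType) (T : topologicalType) (f : T -> K^o) t :
  f t != 0 -> {for t, continuous f} ->
  {for t, continuous ((fun x => (f x)^-1) : T -> K^o)}.
Proof. by move=> f0 fc; exact: (@continuousV K T f). Qed.

Lemma circle_continuousV r g : 0 < r -> (forall z, normc z = r -> g z != 0) ->
  circle_continuous r g -> circle_continuous r (fun z => (g z)^-1).
Proof.
move=> r0 g0 gc t.
have n0 := g0 _ (normc_circle_point t (ltW r0)).
exact: (@continuousV1 R[i] R (fun t => g (circle_point r t)) t n0 (gc t)).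
Qed.

Lemma circle_continuousD r g h : circle_continuous r g -> circle_continuous r h ->
  circle_continuous r (fun z => g z + h z).
Proof.
move=> gc hc t.
exact: (@cvgD R[i] R[i]^o R (nbhs t) _ (fun t => g (circle_point r t))
  (fun t => h (circle_point r t)) _ _ (gc t) (hc t)).
Qed.

Lemma circle_continuous_cst r c : circle_continuous r (fun=> c).
Proof. by move=> t; exact: cst_continuous. Qed.

Lemma circle_continuousI r g : (forall t : R,
  {for t, continuous ((fun t => g (circle_point r t)) : R -> R[i]^o)}) ->
  circle_continuous r g.
Proof. exact. Qed.

Lemma circle_continuousE r g : circle_continuous r g -> forall t : R,
  {for t, continuous ((fun t => g (circle_point r t)) : R -> R[i]^o)}.
Proof. exact. Qed.

Opaque circle_continuous.

Lemma circle_continuousZ r c g : circle_continuous r g ->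
  circle_continuous r (fun z => c * g z).
Proof. exact: (circle_continuousM (@circle_continuous_cst r c)). Qed.

Lemma circle_continuousB r g h : circle_continuous r g -> circle_continuous r h ->
  circle_continuous r (fun z => g z - h z).
Proof.
move=> gc hc; have := circle_continuousD gc (circle_continuousZ (c := -1) hc).
by congr circle_continuous; apply/funext => z; rewrite mulN1r.
Qed.

Lemma circle_continuousXz r (k : int) : 0 < r ->
  circle_continuous r (fun z => z ^ k).
Proof.
move=> r0; apply: circle_continuous_holomorphic => // z zr.
by apply: holomorphic_at_exprz; rewrite -normc_gt0 zr.
Qed.

Lemma circle_continuous_id r : 0 < r -> circle_continuous r (fun z => z).
Proof.
move=> r0; have := @circle_continuousXz r 1 r0; congr circle_continuous.
Qed.

Lemma circle_continuous_sum r n (g : nat -> R[i] -> R[i]) :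
  (forall j, circle_continuous r (g j)) ->
  circle_continuous r (fun z => \sum_(0 <= j < n) g j z).
Proof.
move=> gc; elim: n => [|n IH].
  have -> : (fun z => \sum_(0 <= j < 0) g j z) = (fun=> 0).
    by apply/funext => z; rewrite big_nil.
  exact: circle_continuous_cst.
have -> : (fun z => \sum_(0 <= j < n.+1) g j z) =
    (fun z => \sum_(0 <= j < n) g j z + g n z).
  by apply/funext => z; rewrite big_nat_recr.
exact: (circle_continuousD IH (gc n)).
Qed.

Lemma circle_integrable r g : 0 < r -> circle_continuous r g ->
  Cintegrable 0 (2 * pi)
    (fun t => g (circle_point r t) * ('i%C * circle_point r t)).
Proof.
move=> r0 gc; apply: Cintegrable_continuous => t _.
have ic := circle_continuousZ (c := 'i%C) (circle_continuous_id r0).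
exact: (@circle_continuousE r _ (circle_continuousM gc ic) t).
Qed.

Lemma eq_oint r g h : 0 <= r -> (forall z, normc z = r -> g z = h z) ->
  oint r g = oint r h.
Proof.
move=> r0 gh; congr (_ * _); apply: eq_Cintegral => t _.
by rewrite gh // normc_circle_point.
Qed.

Lemma ointD r g h : 0 < r -> circle_continuous r g -> circle_continuous r h ->
  oint r (fun z => g z + h z) = oint r g + oint r h.
Proof.
move=> r0 /(circle_integrable r0) gi /(circle_integrable r0) hi.
rewrite /oint -mulrDr -(CintegralD gi hi).
by congr (_ * _); apply: eq_Cintegral => t _; rewrite mulrDl.
Qed.

Lemma ointZ r c g : 0 < r -> circle_continuous r g ->
  oint r (fun z => c * g z) = c * oint r g.
Proof.
move=> r0 /(circle_integrable r0) gi.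
rewrite /oint [RHS]mulrCA -(CintegralZ c gi).
by congr (_ * _); apply: eq_Cintegral => t _; rewrite -mulrA.
Qed.

Lemma oint0 r : 0 < r -> oint r (fun=> 0 : R[i]) = 0.
Proof.
move=> r0; have c0 := @circle_continuous_cst r 0.
rewrite -[RHS](mul0r (oint r (fun=> 0))) -(ointZ 0 r0 c0).
by apply: eq_oint => [|z _]; rewrite ?mul0r // ltW.
Qed.

Lemma oint_sum r n (g : nat -> R[i] -> R[i]) : 0 < r ->
  (forall j, circle_continuous r (g j)) ->
  oint r (fun z => \sum_(0 <= j < n) g j z) = \sum_(0 <= j < n) oint r (g j).
Proof.
move=> r0 gc; elim: n => [|n IH].
  rewrite big_nil -[RHS](oint0 r0).
  by apply: eq_oint => [|z _]; rewrite ?big_nil // ltW.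
rewrite big_nat_recr //= -IH -ointD //; last exact: circle_continuous_sum.
by apply: eq_oint => [|z _]; [exact: ltW|rewrite big_nat_recr].
Qed.

Lemma normc_oint_le r M g : 0 < r -> circle_continuous r g ->
  (forall z, normc z = r -> normc (g z) <= M) ->
  normc (oint r g) <= 2 * r * M.
Proof.
move=> r0 gc gM; have pi0 : (0 : R) < pi by exact: pi_gt0.
have pi2 : (0 : R) <= 2 * pi by rewrite mulr_ge0 // ltW.
have := @normc_Cintegral_le R 0 (2 * pi) (M * r) _ pi2 (circle_integrable r0 gc).
have bnd t : 0 <= t <= 2 * pi ->
    normc (g (circle_point r t) * ('i%C * circle_point r t)) <= M * r.
  move=> _; rewrite normcM [normc ('i%C * _)]normcM normc_i mul1r.
  rewrite normc_circle_point ?(ltW r0) //.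
  by rewrite ler_pM2r // gM // normc_circle_point // ltW.
move=> /(_ bnd) H; rewrite /oint normcM normcV !normcM normc_i mulr1.
rewrite normc_real (ger0_norm (ltW pi0)).
have -> : normc (2 : R[i]) = 2.
  have -> : (2 : R[i]) = 2%:C by rewrite rmorphD /= rmorph1.
  by rewrite normc_real ger0_norm.
rewrite mulrC ler_pdivrMr ?mulr_gt0 //; apply: (le_trans H).
by rewrite subr0 le_eqVlt; apply/orP; left; apply/eqP; ring.
Qed.

(** Used for [alpha], a limit of exponentials of polynomials, and for the inner
    integrals of double integrals, limits of geometric sums. *)
Lemma circle_continuous_uniform r g (G : nat -> R[i] -> R[i]) : 0 < r ->
  (forall n, circle_continuous r (G n)) ->
  (forall e, 0 < e -> exists n, forall z, normc z = r ->
     normc (G n z - g z) <= e) ->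
  circle_continuous r g.
Proof.
move=> r0 Gc Gg; apply: circle_continuousI => t.
apply/(@cvgC_normcP R R (nbhs t) _ (fun t => g (circle_point r t))) => e e0.
have e3 : 0 < e / 4 by rewrite divr_gt0.
have [n Hn] := Gg _ e3.
have /(@cvgC_normcP R R (nbhs t) _ (fun t => G n (circle_point r t)))/(_ _ e3) := @circle_continuousE r _ (Gc n) t.
apply: filterS => s Hs.
have nr u := @normc_circle_point R r u (ltW r0).
have H1 := Hn _ (nr t); have H2 := Hn _ (nr s).
have -> : g (circle_point r t) - g (circle_point r s) =
  - (G n (circle_point r t) - g (circle_point r t)) +
  (G n (circle_point r t) - G n (circle_point r s)) +
  (G n (circle_point r s) - g (circle_point r s)) by ring.
apply: (le_lt_trans (normc_triangle _ _)).
have := normc_triangle (- (G n (circle_point r t) - g (circle_point r t)))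
  (G n (circle_point r t) - G n (circle_point r s)).
rewrite normc_opp; move: H1 H2 Hs; clear -e0.
move: (normc _) (normc _) (normc _) (normc _) => *; lra.
Qed.

(** A bound proved for approximations that are easier to handle passes to the
    limit; this replaces the holomorphy of the limit itself. *)
Lemma normc_oint_uniform_le r g (G : nat -> R[i] -> R[i]) B : 0 < r ->
  (forall n, circle_continuous r (G n)) ->
  (forall e, 0 < e -> exists n, forall z, normc z = r ->
     normc (G n z - g z) <= e) ->
  (forall n, normc (oint r (G n)) <= B) -> normc (oint r g) <= B.
Proof.
move=> r0 Gc Gg GB; have gc := circle_continuous_uniform r0 Gc Gg.
apply/ler_addgt0Pr => e e0.
have e2 : 0 < e / (2 * r) by rewrite divr_gt0 // mulr_gt0.
have [n Hn] := Gg _ e2.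
have c1 := circle_continuousB gc (Gc n).
have gE : oint r g = oint r (G n) + oint r (fun z => g z - G n z).
  rewrite -(ointD r0 (Gc n) c1); apply: eq_oint => [|z _]; first exact: ltW.
  by rewrite addrC subrK.
have b2 : normc (oint r (fun z => g z - G n z)) <= 2 * r * (e / (2 * r)).
  apply: (normc_oint_le r0 c1) => z zr.
  by rewrite normc_distC Hn.
rewrite gE; apply: (le_trans (normc_triangle _ _)); apply: lerD => //.
by apply: (le_trans b2); rewrite mulrC divfK // gt_eqF // mulr_gt0.
Qed.

End CircleIntegral.

(** * Exponentials of power series *)

Section PowerSeriesExponential.
Variable R : realType.
Implicit Types (z w : R[i]) (c : nat -> R[i]) (A q r th : R).

Lemma expr_small (C th e : R) : 0 <= th -> th < 1 -> 0 < e ->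
  exists n, C * th ^+ n <= e.
Proof.
move=> th0 th1 e0; have : (fun n => C * th ^+ n) @ \oo --> (0 : R).
  rewrite -[X in _ --> X](mulr0 C); apply: cvgM; first exact: cvg_cst.
  by apply: cvg_expr; rewrite ger0_norm.
move=> /cvgrPdist_lt /(_ _ e0) [n _ /(_ n (leqnn n))] /=.
rewrite sub0r normrN => /ltW H; exists n; apply: le_trans H; exact: ler_norm.
Qed.

Lemma geometric_sum_le th m n : 0 <= th -> th < 1 ->
  \sum_(m <= k < n) th ^+ k <= th ^+ m / (1 - th).
Proof.
move=> th0 th1; have th1' : 0 < 1 - th by rewrite subr_gt0.
have H d : \sum_(m <= k < m + d) th ^+ k <= (th ^+ m - th ^+ (m + d)) / (1 - th).
  elim: d => [|d IH]; first by rewrite addn0 big_geq // subrr mul0r.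
  rewrite addnS big_nat_recr ?leq_addr //=.
  apply: (le_trans (lerD IH (lexx _))); rewrite le_eqVlt; apply/orP; left; apply/eqP.
  by rewrite exprS; field; rewrite gt_eqF.
have [mn|nm] := leqP m n; last first.
  by rewrite big_geq 1?ltnW // divr_ge0 ?exprn_ge0 // ltW.
have := H (n - m)%N; rewrite subnKC // => /le_trans; apply.
by rewrite ler_pM2r ?invr_gt0 // gerBl exprn_ge0.
Qed.

(** The exponents are integers so that the same sums serve [z] and [1 / z] in
    Laurent expansions. *)
Definition psum c n z := \sum_(0 <= m < n) c m * z ^ m%:Z.

Definition pseries_sum c z : R[i] := limn (fun n => psum c n z : R[i]^o).

Definition geometric_bound c A q := forall m, normc (c m) <= A * q ^+ m.

Section Series.
Variables (c : nat -> R[i]) (A q : R).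
Hypotheses (q0 : 0 <= q) (cA : geometric_bound c A q).

Lemma geometric_bound_ge0 : 0 <= A.
Proof. by have := le_trans (normc_ge0 _) (cA 0); rewrite expr0 mulr1. Qed.

Lemma normc_term_le z th m : q * normc z <= th ->
  normc (c m * z ^ m%:Z) <= A * th ^+ m.
Proof.
move=> zth; rewrite normcM normcXz.
apply: (le_trans (ler_wpM2r (exprn_ge0 m (normc_ge0 z)) (cA m))).
rewrite -mulrA -exprMn ler_wpM2l ?geometric_bound_ge0 //.
by apply: lerXn2r; rewrite // nnegrE ?mulr_ge0 ?normc_ge0 //
  (le_trans _ zth) // mulr_ge0 ?normc_ge0.
Qed.

Lemma normc_psum_tail z th m n : q * normc z <= th -> th < 1 -> (m <= n)%N ->
  normc (psum c n z - psum c m z) <= A * th ^+ m / (1 - th).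
Proof.
move=> zth th1 mn; have th0 : 0 <= th.
  by apply: le_trans zth; rewrite mulr_ge0 ?normc_ge0.
rewrite /psum (big_cat_nat (leq0n m) mn) /= addrAC subrr add0r.
apply: (le_trans (normc_sum _ _ _)).
apply: (@le_trans _ _ (\sum_(m <= k < n) A * th ^+ k)).
  by apply: ler_sum => k _; exact: normc_term_le.
rewrite -big_distrr /= -mulrA ler_wpM2l ?geometric_bound_ge0 //.
exact: geometric_sum_le.
Qed.

(** The real and imaginary parts converge absolutely, by comparison with a
    geometric series. *)
Lemma cvg_psum z : q * normc z < 1 ->
  (psum c n z : R[i]^o) @[n --> \oo] --> (pseries_sum c z : R[i]^o).
Proof.
move=> z1; pose th := q * normc z.
have th0 : 0 <= th by rewrite mulr_ge0 ?normc_ge0.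
have part (p : R[i] -> R) : (forall w, `|p w| <= normc w) ->
    cvgn (series (fun m => p (c m * z ^ m%:Z))).
  move=> pw; apply: normed_cvg.
  apply: (@series_le_cvg _ _ (geometric A th)) => [m|m|m|].
  - exact: normr_ge0.
  - by rewrite /geometric /= mulr_ge0 ?geometric_bound_ge0 // exprn_ge0.
  - by apply: (le_trans (pw _)); exact: normc_term_le.
  - by apply: is_cvg_geometric_series; rewrite ger0_norm.
have cR := part _ (@normc_Re R); have cI := part _ (@normc_Im R).
pose l := limn (series (fun m => complex.Re (c m * z ^ m%:Z))) +i*
  limn (series (fun m => complex.Im (c m * z ^ m%:Z))).
have ReE n : complex.Re (psum c n z) = series (fun m => complex.Re (c m * z ^ m%:Z)) n.
  by rewrite /psum /series /= raddf_sum.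
have ImE n : complex.Im (psum c n z) = series (fun m => complex.Im (c m * z ^ m%:Z)) n.
  by rewrite /psum /series /= raddf_sum.
have H : (psum c n z : R[i]^o) @[n --> \oo] --> (l : R[i]^o).
  apply: (@cvgC_Re_Im R nat \oo _ (fun n => psum c n z) l).
    by under eq_cvg do rewrite ReE; exact: cR.
  by under eq_cvg do rewrite ImE; exact: cI.
by rewrite /pseries_sum (cvg_lim (@norm_hausdorff R[i] R[i]^o) H).
Qed.

Lemma normc_pseries_tail z th m : q * normc z <= th -> th < 1 ->
  normc (pseries_sum c z - psum c m z) <= A * th ^+ m / (1 - th).
Proof.
move=> zth th1; have z1 : q * normc z < 1 by exact: le_lt_trans th1.
have /(@cvgC_normcP R nat \oo _ (fun n => psum c n z)) H := cvg_psum z1.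
apply/ler_addgt0Pr => e e0; have [N _ HN] := H _ e0.
have := HN (maxn m N) (leq_maxr _ _) => /= /ltW h1.
have h2 := normc_psum_tail zth th1 (leq_maxl m N).
have -> : pseries_sum c z - psum c m z =
  (psum c (maxn m N) z - psum c m z) + (pseries_sum c z - psum c (maxn m N) z).
  by ring.
by apply: (le_trans (normc_triangle _ _)); exact: lerD.
Qed.

Lemma normc_psum_le z th n : q * normc z <= th -> th < 1 ->
  normc (psum c n z) <= A / (1 - th).
Proof.
move=> zth th1; have := normc_psum_tail zth th1 (leq0n n).
by rewrite /psum [X in _ - X]big_nil subr0 expr0 mulr1.
Qed.

Lemma normc_pseries_le z th : q * normc z <= th -> th < 1 ->
  normc (pseries_sum c z) <= A / (1 - th).
Proof.
move=> zth th1; have := normc_pseries_tail 0 zth th1.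
by rewrite /psum big_nil subr0 expr0 mulr1.
Qed.

Lemma Cexp_near0 (e : R) : 0 < e ->
  exists2 d : R, 0 < d & forall w, normc w < d -> normc (Cexp w - 1) <= e.
Proof.
move=> e0; have := holomorphic_at_continuous (@derivable_Cexp R 0).
move=> /(@cvgC_normcP R R[i]^o (nbhs (0 : R[i]^o)) _ (@Cexp R))/(_ _ e0) H.
have [d d0 Hd] := nearC_normc H.
exists d => // w wd; have := Hd w; rewrite subr0 Cexp0 => /(_ wd)/ltW.
by rewrite normc_distC.
Qed.

(** After truncation, holomorphy is a matter of the rules of differentiation. *)
Lemma holomorphic_at_exp_psum (e : int) n z : z != 0 ->
  holomorphic_at (fun w => Cexp (- psum c n (w ^ e))) z.
Proof.
move=> z0; have de := @holomorphic_at_exprz R e z z0.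
have ze : z ^ e != 0 by rewrite expfz_neq0.
have dp : holomorphic_at (psum c n) (z ^ e).
  apply: (@holomorphic_at_sum R n (fun m w => c m * w ^ m%:Z)) => m.
  exact: (holomorphic_atM (@holomorphic_at_cst R (c m) (z ^ e))
    (@holomorphic_at_exprz R m%:Z _ ze)).
have dN : holomorphic_at (fun w => - 1 * psum c n w) (z ^ e).
  exact: (holomorphic_atM (@holomorphic_at_cst R (- 1) (z ^ e)) dp).
have dNe : holomorphic_at (fun w => - 1 * psum c n (w ^ e)) z.
  exact: (@holomorphic_at_comp R (fun w => - 1 * psum c n w) (fun w => w ^ e) z de dN).
have dE := @derivable_Cexp R (- 1 * psum c n (z ^ e)).
have -> : (fun w => Cexp (- psum c n (w ^ e))) =
    (fun w => Cexp (- 1 * psum c n (w ^ e))).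
  by apply/funext => w; rewrite mulN1r.
exact: (@holomorphic_at_comp R (@Cexp R) (fun w => - 1 * psum c n (w ^ e)) z dNe dE).
Qed.

(** Since [Cexp a - Cexp b = Cexp b * (Cexp (a - b) - 1)], uniform convergence
    of the bounded exponents gives that of the exponentials. *)
Lemma exp_psum_uniform (e : int) r M (g : R[i] -> R[i]) : 0 < r -> q * r ^ e < 1 ->
  (forall z, normc z = r -> normc (g z) <= M) ->
  forall d : R, 0 < d -> exists n, forall z, normc z = r ->
    normc (g z * Cexp (- psum c n (z ^ e)) -
      g z * Cexp (- pseries_sum c (z ^ e))) <= d.
Proof.
move=> r0 qr gM d d0; set th := q * r ^ e in qr.
have th0 : 0 <= th by rewrite mulr_ge0 // exprz_ge0 // ltW.
pose B := expR (A / (1 - th)).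
have B0 : 0 < B by exact: expR_gt0.
have M0 : 0 < `|M| + 1 by rewrite ltr_wpDl.
have [d1 d10 Hd1] := Cexp_near0 (divr_gt0 d0 (mulr_gt0 M0 B0)).
have [n Hn] := expr_small (A / (1 - th)) th0 qr (divr_gt0 d10 (ltr0Sn R 1)).
exists n => z zr; have zth : q * normc (z ^ e) <= th by rewrite normcXz zr.
have -> : g z * Cexp (- psum c n (z ^ e)) - g z * Cexp (- pseries_sum c (z ^ e)) =
    g z * (Cexp (- pseries_sum c (z ^ e)) *
      (Cexp (pseries_sum c (z ^ e) - psum c n (z ^ e)) - 1)).
  rewrite mulrBr mulr1 -CexpD addrA addNr add0r; ring.
have h1 : normc (Cexp (pseries_sum c (z ^ e) - psum c n (z ^ e)) - 1) <=
    d / ((`|M| + 1) * B).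
  apply: Hd1; apply: (le_lt_trans (normc_pseries_tail n zth qr)).
  rewrite mulrAC; apply: (le_lt_trans Hn).
  by rewrite ltr_pdivrMr // mulr_natr mulr2n ltrDl.
have h2 : normc (Cexp (- pseries_sum c (z ^ e))) <= B.
  apply: (le_trans (normc_Cexp_le _)); rewrite ler_expR normc_opp.
  exact: normc_pseries_le.
have h3 : normc (g z) <= `|M| + 1.
  by apply: (le_trans (gM z zr)); apply: (le_trans (ler_norm M)); rewrite lerDl.
rewrite normcM [normc (Cexp _ * _)]normcM mulrA.
have -> : d = ((`|M| + 1) * B) * (d / ((`|M| + 1) * B)).
  by rewrite mulrC divfK // gt_eqF // mulr_gt0.
have h4 : normc (g z) * normc (Cexp (- pseries_sum c (z ^ e))) <= (`|M| + 1) * B.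
  by apply: ler_pM h3 h2; exact: normc_ge0.
by apply: ler_pM h4 h1; [rewrite mulr_ge0 ?normc_ge0|exact: normc_ge0].
Qed.

Lemma circle_continuous_exp_psum (e : int) r n : 0 < r ->
  circle_continuous r (fun z => Cexp (- psum c n (z ^ e))).
Proof.
move=> r0; apply: circle_continuous_holomorphic => // z zr.
by apply: holomorphic_at_exp_psum; rewrite -normc_gt0 zr.
Qed.

Lemma circle_continuous_exp_pseries (e : int) r : 0 < r -> q * r ^ e < 1 ->
  circle_continuous r (fun z => Cexp (- pseries_sum c (z ^ e))).
Proof.
move=> r0 qr; have g1 (z : R[i]) : normc z = r -> normc (1 : R[i]) <= 1.
  by rewrite normc1.
pose G n (z : R[i]) := Cexp (- psum c n (z ^ e)).
apply: (@circle_continuous_uniform R r _ G r0) => [n|d d0].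
  exact: circle_continuous_exp_psum.
have [n Hn] := exp_psum_uniform r0 qr g1 d0.
by exists n => z zr; have := Hn z zr; rewrite !mul1r.
Qed.

Lemma normc_exp_pseries_le (e : int) r z : 0 < r -> q * r ^ e < 1 ->
  normc z = r ->
  normc (Cexp (- pseries_sum c (z ^ e))) <= expR (A / (1 - q * r ^ e)) /\
  normc (Cexp (- pseries_sum c (z ^ e)))^-1 <= expR (A / (1 - q * r ^ e)).
Proof.
move=> r0 qr zr; have zth : q * normc (z ^ e) <= q * r ^ e by rewrite normcXz zr.
split.
  apply: (le_trans (normc_Cexp_le _)); rewrite ler_expR normc_opp.
  exact: normc_pseries_le.
rewrite -CexpN opprK; apply: (le_trans (normc_Cexp_le _)); rewrite ler_expR.
exact: normc_pseries_le.
Qed.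

(** Fourier coefficients of the exponential of the series on the circle of
    radius [r] are controlled by any other radius [r'] at which the series still
    converges. The contour is moved for the truncated series, which is
    holomorphic by inspection, with a bound that does not depend on the
    truncation. *)
Lemma normc_oint_exp_pseries_le (e k : int) r r' : 0 < r -> 0 < r' ->
  q * r ^ e < 1 -> q * r' ^ e < 1 ->
  normc (oint r (fun z => z ^ k * Cexp (- pseries_sum c (z ^ e)))) <=
  2 * r' * (r' ^ k * expR (A / (1 - q * r' ^ e))).
Proof.
move=> r0 r'0 qr qr'.
pose G n (z : R[i]) := z ^ k * Cexp (- psum c n (z ^ e)).
have Gh n z : z != 0 -> holomorphic_at (G n) z.
  move=> z0; exact: (holomorphic_atM (@holomorphic_at_exprz R k z z0)
    (@holomorphic_at_exp_psum e n z z0)).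
have Gc s n : 0 < s -> circle_continuous s (G n).
  move=> s0; apply: circle_continuous_holomorphic => // z zs.
  by apply: Gh; rewrite -normc_gt0 zs.
apply: (@normc_oint_uniform_le R r _ G) => // [n|d d0|n]; first exact: Gc.
  have gM (z : R[i]) : normc z = r -> normc (z ^ k) <= r ^ k.
    by move=> zr; rewrite normcXz zr.
  exact: (exp_psum_uniform r0 qr gM d0).
rewrite (@oint_shift R (G n) r r') // => [|z /andP[zmin _]]; last first.
  apply: Gh; rewrite -normc_gt0; apply: lt_le_trans zmin.
  by rewrite lt_min r0.
apply: (normc_oint_le r'0 (Gc r' n r'0)) => z zr.
rewrite /G normcM normcXz zr ler_wpM2l ?exprz_ge0 ?(ltW r'0) //.
apply: (le_trans (normc_Cexp_le _)); rewrite ler_expR normc_opp.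
by apply: normc_psum_le => //; rewrite normcXz zr.
Qed.

End Series.
End PowerSeriesExponential.

(** * Exponential decay of Laurent coefficients *)

Section FourierDecay.
Variable R : realType.
Implicit Types (z w : R[i]) (g : R[i] -> R[i]) (r q d : R).

(** Points given by their modulus are reached by the parametrization of
    circles, so estimates on a circle and over [[0, 2 pi]] are interchangeable. *)
Lemma polar_form z : z != 0 ->
  exists2 t : R, 0 <= t <= 2 * pi & z = circle_point (normc z) t.
Proof.
move=> z0; have nz : 0 < normc z by rewrite normc_gt0.
pose u := z / (normc z)%:C; case uE : u => [a b].
have nu1 : normc u = 1.
  by rewrite /u normcM normcV normc_real ger0_norm ?ltW // divff ?gt_eqF.
have nu : a ^+ 2 + b ^+ 2 = 1.
  move: nu1; rewrite uE /normc /= => /(congr1 (fun x => x ^+ 2)).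
  by rewrite sqr_sqrtr ?addr_ge0 ?sqr_ge0 // expr1n.
have a1 : -1 <= a <= 1.
  by have := normc_Re u; rewrite nu1 uE ler_norml.
have pi0 := @pi_ge0 R.
have ac0 := acos_ge0 a1; have acp := acos_lepi a1.
have cE : cos (acos a) = a by rewrite acosK // in_itv.
have sE : sin (acos a) = `|b|.
  by rewrite sin_acos // -nu addrAC subrr add0r sqrtr_sqr.
have zE : z = (normc z)%:C * (a +i* b).
  rewrite -uE /u mulrC divfK //; apply: contraTneq nz => /(congr1 (@complex.Re R)) /= ->.
  by rewrite ltxx.
have [b0|/ltW b0] := leP 0 b.
  exists (acos a); first by rewrite ac0 (le_trans acp) // ler_peMl // ler1n.
  by rewrite {1}zE /circle_point cE sE ger0_norm.
exists (2 * pi - acos a).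
  by apply/andP; split; lra.
rewrite {1}zE /circle_point mulr_natl cosB sinB cos2pi sin2pi cE sE ler0_norm //.
by rewrite !mul0r !mul1r addr0 sub0r opprK.
Qed.

Lemma circle_bounded r g : 0 < r -> circle_continuous r g ->
  exists M, forall z, normc z = r -> normc (g z) <= M.
Proof.
move=> r0 gc; have pi2 : (0 : R) <= 2 * pi by rewrite mulr_ge0 // pi_ge0.
have cN : {within `[0, 2 * pi], continuous (fun t => normc (g (circle_point r t)))}.
  apply: continuous_subspaceT => t.
  apply: (@continuous_comp _ _ _ ((fun t => g (circle_point r t)) : R -> R[i]^o)
    (@normc R : R[i]^o -> R)); last exact: continuous_normc.
  exact: (@circle_continuousE R r g gc t).
have [t _ Ht] := EVT_max pi2 cN.
exists (normc (g (circle_point r t))) => z zr.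
have z0 : z != 0 by rewrite -normc_gt0 zr.
have [s sI ->] := polar_form z0; rewrite zr; apply: Ht.
by rewrite in_itv.
Qed.

(** An open set containing the unit circle contains a closed annulus around it,
    by compactness of the interval of angles. *)
Lemma open_nbhs_annulus (U : set R[i]) : open_nbhs_unit_circle U ->
  exists2 d, 0 < d & forall z, expR (- d) <= normc z <= expR d -> U z.
Proof.
move=> [Uo Uc]; pose P (x t : R) := U (Cexp (x +i* t)).
have cov : forall t : R, `[0, 2 * pi]%classic t ->
    \forall t' \near t & x \near (0 : R), P x t'.
  move=> t _; have UE : U (Cexp (0 +i* t)).
    apply: Uc; rewrite normrE normc_Cexp expR0 //.
  have := holomorphic_at_continuous (@derivable_Cexp R (0 +i* t)).
  have /(_ UE) nU : U (Cexp (0 +i* t)) -> nbhs (Cexp (0 +i* t) : R[i]^o) U.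
    by move: Uo; rewrite openE; apply.
  move=> /(_ _ nU) H; have [e e0 He] := nearC_normc H.
  have e2 : 0 < e / 2 by rewrite divr_gt0.
  exists (ball t (e / 2), ball (0 : R) (e / 2)).
    by split; exact: nbhsx_ballx.
  move=> [t' x] /= [tt' xx']; apply: He.
  have -> : (x +i* t') - (0 +i* t) = (x - 0) +i* (t' - t) by [].
  apply: (le_lt_trans (normc_le _)); rewrite [e]splitr /=.
  by apply: ltrD; rewrite distrC.
have NC := (compact_near_coveringP _).1 (@segment_compact R 0 (2 * pi)).
have nP : nbhs (0 : R) (fun x => `[0, 2 * pi]%classic `<=` P x).
  exact: (NC R (nbhs (0 : R)) P _ cov).
have [d /= d0 Hd] := (nbhs_ballP _ _).1 nP.
exists (d / 2); first by rewrite divr_gt0.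
move=> z /andP[z1 z2].
have nz : 0 < normc z by apply: lt_le_trans z1; exact: expR_gt0.
have z0 : z != 0 by rewrite -normc_gt0.
have [t tI ->] := polar_form z0.
rewrite -(lnK (nz : normc z \is Num.pos)) circle_point_expR.
apply: (Hd (ln (normc z))); last by rewrite /= in_itv.
rewrite /ball /= sub0r normrN; apply: (@le_lt_trans _ _ (d / 2)); last first.
  by rewrite ltr_pdivrMr // mulr_natr mulr2n ltrDl.
rewrite ler_norml -[- (d / 2)]expRK -[X in _ && (_ <= X)]expRK.
by rewrite !ler_ln ?posrE ?expR_gt0 // z1.
Qed.

(** The contour defining the Laurent coefficient of index [m] can be moved
    slightly outwards or inwards according to the sign of [m]. *)
Lemma laurent_coef_decay (U : set R[i]) g : open_nbhs_unit_circle U ->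
  holomorphic_on U g -> exists d A, [/\ 0 < d,
    geometric_bound (fun m => laurent_coef g m%:Z) A (expR (- d)) &
    geometric_bound (fun m => laurent_coef g (- m%:Z)) A (expR (- d))].
Proof.
move=> Un dg; have [d d0 HU] := open_nbhs_annulus Un.
have ed : expR (- d) <= 1 by rewrite -expR0 ler_expR oppr_le0 ltW.
have ed' : 1 <= expR d by rewrite -expR0 ler_expR ltW.
have gh z : expR (- d) <= normc z <= expR d -> holomorphic_at g z.
  by move=> /HU; exact: dg.
have gc r : expR (- d) <= r <= expR d -> circle_continuous r g.
  move=> rI; apply: circle_continuous_holomorphic => [|z zr].
    by case/andP: rI => + _; apply: lt_le_trans; exact: expR_gt0.
  by apply: gh; rewrite zr.
have coefE r (m : int) : expR (- d) <= r <= expR d ->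
    laurent_coef g m = oint r (fun z => g z * z ^ (- (m + 1))).
  move=> rI; have r0 : 0 < r.
    by case/andP: rI => + _; apply: lt_le_trans; exact: expR_gt0.
  rewrite /laurent_coef.
  have -> : (fun z => g z / z ^ (m + 1)) = (fun z => g z * z ^ (- (m + 1))).
    by apply/funext => z; rewrite invr_expz.
  apply: oint_shift => // z /andP[zm zM].
  have z1 : expR (- d) <= normc z.
    by apply: le_trans zm; rewrite le_min ed; case/andP: rI.
  have z2 : normc z <= expR d.
    by apply: (le_trans zM); rewrite ge_max ed'; case/andP: rI.
  have z0 : z != 0 by rewrite -normc_gt0; apply: lt_le_trans z1; exact: expR_gt0.
  apply: (@holomorphic_atM R g (fun z => z ^ (- (m + 1)))).
    by apply: gh; rewrite z1.
  exact: holomorphic_at_exprz.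
have bound r : expR (- d) <= r <= expR d -> exists M, forall m : int,
    normc (laurent_coef g m) <= M * r ^ (- m).
  move=> rI; have r0 : 0 < r.
    by case/andP: rI => + _; apply: lt_le_trans; exact: expR_gt0.
  have [M HM] := circle_bounded r0 (gc r rI).
  exists (2 * M) => m; rewrite (coefE r m rI).
  have -> : 2 * M * r ^ (- m) = 2 * r * (M * r ^ (- (m + 1))).
    rewrite opprD expfzDr ?gt_eqF // exprN1; field; rewrite ?gt_eqF //.
  apply: normc_oint_le => // [|z zr].
    by apply: circle_continuousM; [exact: gc|exact: circle_continuousXz].
  by rewrite normcM normcXz zr ler_wpM2r ?HM // exprz_ge0 // ltW.
have [M1 HM1] := bound (expR d) ltac:(rewrite lexx (le_trans ed) //).
have [M2 HM2] := bound (expR (- d)) ltac:(rewrite lexx (le_trans ed) //).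
exists d, (Num.max M1 M2); split=> // m.
  apply: (le_trans (HM1 _)); rewrite -exprnN -exprVn -expRN.
  by rewrite ler_wpM2r ?exprn_ge0 ?expR_ge0 // le_max lexx.
apply: (le_trans (HM2 _)); rewrite opprK.
by rewrite ler_wpM2r ?exprz_ge0 ?expR_ge0 // le_max lexx orbT.
Qed.

End FourierDecay.

(** * Double integrals against the Cauchy kernel *)

Section DoubleIntegral.
Variable R : realType.
Implicit Types (z s w : R[i]) (r : R).

Lemma circle_continuousX r (g : R[i] -> R[i]) n : circle_continuous r g ->
  circle_continuous r (fun z => g z ^+ n).
Proof.
move=> gc; elim: n => [|n IH].
  have -> : (fun z => g z ^+ 0) = (fun=> 1) by apply/funext => z; rewrite expr0.
  exact: circle_continuous_cst.
have -> : (fun z => g z ^+ n.+1) = (fun z => g z * g z ^+ n).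
  by apply/funext => z; rewrite exprS.
exact: circle_continuousM.
Qed.

Lemma geometric_remainder w n : w != 1 ->
  (1 - w)^-1 = \sum_(0 <= j < n) w ^+ j + w ^+ n / (1 - w).
Proof.
move=> w1; have w0 : 1 - w != 0 by rewrite subr_eq0 eq_sym.
elim: n => [|n IH]; first by rewrite big_nil add0r expr0 mul1r.
rewrite big_nat_recr //= [LHS]IH exprS -addrA; congr (_ + _).
by field.
Qed.

Lemma normc_subr1_ge w x : normc w <= x -> 1 - x <= normc (1 - w).
Proof.
move=> wx; rewrite lerBlDr; apply: (@le_trans _ _ (normc (1 - w) + normc w)).
  by rewrite -[X in X <= _](@normc1 R) -{1}(subrK w 1) normc_triangle.
by rewrite lerD2l.
Qed.

(** Expanding the kernel in a geometric series turns the double integral into a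
    series of products of single integrals, so that bounds obtained by moving
    each contour separately may be multiplied. *)
Lemma normc_double_oint_le (rz rs : R) (Phi X Psi Y : R[i] -> R[i])
    (x y B th : R) : 0 < rz -> 0 < rs ->
  circle_continuous rz Phi -> circle_continuous rz X ->
  circle_continuous rs Psi -> circle_continuous rs Y ->
  (forall z, normc z = rz -> normc (X z) = x) ->
  (forall s, normc s = rs -> normc (Y s) = y) ->
  0 <= x -> 0 <= y -> x * y < 1 -> 0 <= B -> 0 <= th -> th < 1 ->
  (forall j, normc (oint rz (fun z => Phi z * X z ^+ j)) *
             normc (oint rs (fun s => Psi s * Y s ^+ j)) <= B * th ^+ j) ->
  normc (oint rz (fun z => oint rs (fun s =>
     Phi z * Psi s / (1 - X z * Y s)))) <= B / (1 - th).
Proof.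
move=> rz0 rs0 Phic Xc Psic Yc Xx Yy x0 y0 xy1 B0 th0 th1 HB.
have [MP HP] := circle_bounded rz0 Phic; have [MS HS] := circle_bounded rs0 Psic.
have xy0 : 0 <= x * y by rewrite mulr_ge0.
have xy1' : 0 < 1 - x * y by rewrite subr_gt0.
have nXY z s : normc z = rz -> normc s = rs -> normc (X z * Y s) = x * y.
  by move=> zr sr; rewrite normcM Xx // Yy.
have XY1 z s : normc z = rz -> normc s = rs -> 1 - X z * Y s != 0.
  move=> zr sr; rewrite -normc_gt0; apply: lt_le_trans xy1' _.
  by apply: normc_subr1_ge; rewrite nXY.
have invc z : normc z = rz -> circle_continuous rs (fun s => (1 - X z * Y s)^-1).
  move=> zr; have n0 s : normc s = rs -> 1 - X z * Y s != 0 by exact: XY1.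
  have c1 := circle_continuousB (@circle_continuous_cst R rs 1)
    (@circle_continuousZ R rs (X z) Y Yc).
  exact: (@circle_continuousV R rs (fun s => 1 - X z * Y s) rs0 n0 c1).
have PYc j : circle_continuous rs (fun s => Psi s * Y s ^+ j).
  exact: (circle_continuousM Psic (@circle_continuousX rs Y j Yc)).
have PXc j : circle_continuous rz (fun z => Phi z * X z ^+ j).
  exact: (circle_continuousM Phic (@circle_continuousX rz X j Xc)).
pose b j := oint rs (fun s => Psi s * Y s ^+ j).
pose G n z := \sum_(0 <= j < n) b j * (Phi z * X z ^+ j).
have remc n z : normc z = rz -> circle_continuous rs
    (fun s => Phi z * X z ^+ n * (Psi s * Y s ^+ n * (1 - X z * Y s)^-1)).
  move=> zr; have := circle_continuousM (PYc n) (invc z zr).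
  exact: circle_continuousZ.
have innerE n z : normc z = rz ->
    oint rs (fun s => Phi z * Psi s / (1 - X z * Y s)) =
    G n z + oint rs (fun s =>
      Phi z * X z ^+ n * (Psi s * Y s ^+ n * (1 - X z * Y s)^-1)).
  move=> zr; pose H j (s : R[i]) := (Phi z * X z ^+ j) * (Psi s * Y s ^+ j).
  have Hc j : circle_continuous rs (H j) by exact: (circle_continuousZ (PYc j)).
  have -> : G n z = oint rs (fun s => \sum_(0 <= j < n) H j s).
    rewrite (oint_sum n rs0 Hc); apply: eq_bigr => j _.
    by rewrite (ointZ (Phi z * X z ^+ j) rs0 (PYc j)) mulrC.
  rewrite -(ointD rs0 (@circle_continuous_sum R rs n H Hc) (remc n z zr)).
  apply: eq_oint => [|s sr]; first exact: ltW.
  have w1 : X z * Y s != 1 by have := XY1 z s zr sr; rewrite subr_eq0 eq_sym.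
  rewrite [X in _ * X = _](geometric_remainder n w1) mulrDr big_distrr /=; congr (_ + _).
    by apply: eq_bigr => j _; rewrite /H exprMn; ring.
  by rewrite exprMn; field; exact: XY1.
have bPc j : circle_continuous rz (fun z => b j * (Phi z * X z ^+ j)).
  exact: (circle_continuousZ (PXc j)).
apply: (@normc_oint_uniform_le R rz _ G _ rz0) => [n|e e0|n].
- exact: (@circle_continuous_sum R rz n (fun j z => b j * (Phi z * X z ^+ j)) bPc).
- have [n Hn] := expr_small (2 * rs * ((`|MP| * `|MS|) / (1 - x * y))) xy0 xy1 e0.
  exists n => z zr; rewrite (innerE n z zr) opprD addrA subrr add0r normc_opp.
  apply: le_trans Hn.
  have -> : 2 * rs * ((`|MP| * `|MS|) / (1 - x * y)) * (x * y) ^+ n =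
     2 * rs * (`|MP| * x ^+ n * (`|MS| * y ^+ n * (1 - x * y)^-1)).
    by rewrite exprMn; ring.
  apply: (normc_oint_le rs0 (remc n z zr)) => s sr.
  have hP : normc (Phi z) <= `|MP| by apply: (le_trans (HP z zr)); exact: ler_norm.
  have hS : normc (Psi s) <= `|MS| by apply: (le_trans (HS s sr)); exact: ler_norm.
  rewrite normcM [normc (Phi z * _)]normcM [normc (Psi s * _ * _)]normcM.
  rewrite [normc (Psi s * _)]normcM !normcX Xx // Yy // normcV.
  have hI : (normc (1 - X z * Y s))^-1 <= (1 - x * y)^-1.
    rewrite lef_pV2 ?posrE // ?normc_gt0 ?XY1 //.
    by apply: normc_subr1_ge; rewrite nXY.
  apply: ler_pM; rewrite ?mulr_ge0 ?invr_ge0 ?normc_ge0 ?exprn_ge0 //.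
    by rewrite ler_wpM2r ?exprn_ge0.
  apply: ler_pM; rewrite ?mulr_ge0 ?invr_ge0 ?normc_ge0 ?exprn_ge0 //.
  by rewrite ler_wpM2r ?exprn_ge0.
rewrite (oint_sum n rz0 bPc).
apply: (le_trans (normc_sum _ _ _)).
apply: (@le_trans _ _ (\sum_(0 <= j < n) B * th ^+ j)).
  by apply: ler_sum => j _; rewrite (ointZ (b j) rz0 (PXc j)) normcM mulrC.
rewrite -big_distrr /= ler_wpM2l //.
by have := geometric_sum_le 0 n th0 th1; rewrite expr0 div1r.
Qed.

End DoubleIntegral.

(** * Bounds on the double integrals of the matrix entries *)

Section ExponentialKernel.
Variable R : realType.
Implicit Types (z s : R[i]) (k l e : int).

(** The double integrals of both signs are instances of this one: [e = 1] for
    contours inside the unit disc and [e = -1] for contours outside. The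
    [z]-contour is moved to an arbitrary radius [r'] of convergence; the
    constant does not depend on the exponents. The unit [kap] absorbs the sign of
    [1 / (z - s)], which is expanded in powers of [s / z] or of [z / s]. *)
Lemma normc_exp_kernel_le (c : nat -> R[i]) (A q rz rs r' : R)
    (kap : R[i]) e : normc kap = 1 ->
  0 <= q -> geometric_bound c A q -> 0 < rz -> 0 < rs -> 0 < r' ->
  q * rz ^ e < 1 -> q * rs ^ e < 1 -> q * r' ^ e < 1 ->
  rs ^ e < rz ^ e -> rs ^ e < r' ^ e ->
  exists2 K : R, 0 <= K & forall k l,
    normc (oint rz (fun z => oint rs (fun s =>
      (z ^ k * Cexp (- pseries_sum c (z ^ e))) *
      (kap * (s ^ l * (Cexp (- pseries_sum c (s ^ e)))^-1)) /
      (1 - z ^ (- e) * s ^ e)))) <= K * (r' ^ k * rs ^ l).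
Proof.
move=> kap1 q0 cA rz0 rs0 r'0 qz qs qr' sz sr'.
pose C1 := expR (A / (1 - q * r' ^ e)); pose C2 := expR (A / (1 - q * rs ^ e)).
have C10 : 0 < C1 by exact: expR_gt0.
have C20 : 0 < C2 by exact: expR_gt0.
pose th := rs ^ e / r' ^ e.
have rs_e : 0 < rs ^ e by exact: exprz_gt0.
have r'_e : 0 < r' ^ e by exact: exprz_gt0.
have rz_e : 0 < rz ^ e by exact: exprz_gt0.
have th0 : 0 <= th by rewrite divr_ge0 // ltW.
have th1 : th < 1 by rewrite ltr_pdivrMr // mul1r.
have th1' : 0 < 1 - th by rewrite subr_gt0.
exists (4 * r' * rs * C1 * C2 / (1 - th)).
  by rewrite divr_ge0 ?mulr_ge0 // ltW.
move=> k l; pose E (z : R[i]) := Cexp (- pseries_sum c (z ^ e)).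
have Ez : circle_continuous rz E.
  exact: (@circle_continuous_exp_pseries R c A q q0 cA e rz rz0 qz).
have Es : circle_continuous rs E.
  exact: (@circle_continuous_exp_pseries R c A q q0 cA e rs rs0 qs).
have EVs : circle_continuous rs (fun s => (E s)^-1).
  exact: (@circle_continuousV R rs E rs0 (fun s _ => Cexp_neq0 _) Es).
have Pc : circle_continuous rz (fun z => z ^ k * E z).
  exact: (circle_continuousM (@circle_continuousXz R rz k rz0) Ez).
have Qc m : circle_continuous rs (fun s => kap * (s ^ m * (E s)^-1)).
  apply: circle_continuousZ.
  exact: (circle_continuousM (@circle_continuousXz R rs m rs0) EVs).
pose B := (2 * r' * (r' ^ k * C1)) * (2 * rs * (rs ^ l * C2)).
have B0 : 0 <= B by rewrite !mulr_ge0 ?exprz_ge0 // ltW.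
have -> : 4 * r' * rs * C1 * C2 / (1 - th) * (r' ^ k * rs ^ l) = B / (1 - th).
  by rewrite /B; field; rewrite gt_eqF.
apply: (@normc_double_oint_le R rz rs (fun z => z ^ k * E z) (fun z => z ^ (- e))
  (fun s => kap * (s ^ l * (E s)^-1)) (fun s => s ^ e) (rz ^ (- e)) (rs ^ e) B th
  rz0 rs0 Pc _ (Qc l)).
- exact: circle_continuousXz.
- exact: circle_continuousXz.
- by move=> z zr; rewrite normcXz zr.
- by move=> s sr; rewrite normcXz sr.
- by rewrite exprz_ge0 // ltW.
- exact: ltW.
- by rewrite -invr_expz mulrC ltr_pdivrMr // mul1r.
- by [].
- by [].
- by [].
move=> j.
have E1 : oint rz (fun z => z ^ k * E z * (z ^ (- e)) ^+ j) =
    oint rz (fun z => z ^ (k - e * j%:Z) * E z).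
  apply: eq_oint => [|z zr]; first exact: ltW.
  have z0 : z != 0 by rewrite -normc_gt0 zr.
  by rewrite expfzDr // -mulNr -exprz_exp -exprnP mulrAC.
have E2 : oint rs (fun s => kap * (s ^ l * (E s)^-1) * (s ^ e) ^+ j) =
    oint rs (fun s => kap * (s ^ (l + e * j%:Z) * (E s)^-1)).
  apply: eq_oint => [|s sr]; first exact: ltW.
  have s0 : s != 0 by rewrite -normc_gt0 sr.
  by rewrite expfzDr // -exprz_exp -exprnP -mulrA; congr (_ * _); rewrite mulrAC.
rewrite E1 E2.
have H1 := @normc_oint_exp_pseries_le R c A q q0 cA e (k - e * j%:Z) rz r' rz0 r'0 qz qr'.
have H2 : normc (oint rs (fun s => kap * (s ^ (l + e * j%:Z) * (E s)^-1))) <=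
    2 * rs * (rs ^ (l + e * j%:Z) * C2).
  apply: (normc_oint_le rs0 (Qc _)) => s sr.
  rewrite normcM kap1 mul1r normcM normcXz sr ler_wpM2l ?exprz_ge0 ?(ltW rs0) //.
  by have [_] := @normc_exp_pseries_le R c A q q0 cA e rs s rs0 qs sr.
apply: (le_trans (ler_pM (normc_ge0 _) (normc_ge0 _) H1 H2)).
rewrite le_eqVlt; apply/orP; left; apply/eqP.
rewrite !expfzDr ?gt_eqF // -mulNr -!exprz_exp -!exprnP -invr_expz /B /th -/C1.
rewrite expr_div_n exprVn; field.
by rewrite expf_neq0 // gt_eqF.
Qed.

End ExponentialKernel.

Section Kernels.
Variable F : fieldType.
Implicit Types (z s a b : F) (u v : int).

Lemma inside_kernelE z s a b a' b' u v : a' = a -> b' = b ->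
  b != 0 -> z != 0 -> z - s != 0 ->
  (z ^ (v - 1) * a) * (1 * (s ^ u * b^-1)) / (1 - z ^ (- 1) * s ^ 1) =
  a' / b' * (s ^ u * z ^ v / (z - s)).
Proof.
move=> -> -> b0 z0 zs; rewrite expfzDr // exprN1 expr1z; field.
by rewrite b0 z0 zs.
Qed.

Lemma outside_kernelE z s a b a' b' u v : a' = a^-1 -> b' = b^-1 ->
  a != 0 -> b != 0 -> s != 0 -> z - s != 0 ->
  (z ^ v * a) * (- 1 * (s ^ (u - 1) * b^-1)) / (1 - z ^ (- - 1) * s ^ (- 1)) =
  b' / a' * (s ^ u * z ^ v / (z - s)).
Proof.
move=> -> -> a0 b0 s0 zs; rewrite expfzDr // opprK exprN1 expr1z; field.
have sz : s - z != 0 by rewrite -opprB oppr_eq0.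
by rewrite a0 b0 s0 oner_eq0 zs sz.
Qed.

End Kernels.

Section SzegoBounds.
Variables (R : realType) (lnf : R[i] -> R[i]) (d A : R).
Hypothesis d0 : 0 < d.
Hypothesis cP : geometric_bound (fun m => laurent_coef lnf m%:Z) A (expR (- d)).
Hypothesis cN : geometric_bound (fun m => laurent_coef lnf (- m%:Z)) A (expR (- d)).

(* The outer product starts at [m = 1]; padding with 0 makes it a power series
   in [1 / z]. *)
Let cout (m : nat) : R[i] := if m == 0%N then 0 else laurent_coef lnf (- m%:Z).

Let cout_bound : geometric_bound cout A (expR (- d)).
Proof.
move=> [|m]; last exact: cN.
have -> : normc (cout 0) = 0 by apply/eqP; rewrite normc_eq0.
by rewrite mulr_ge0 ?(geometric_bound_ge0 cP) ?exprn_ge0 ?expR_ge0.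
Qed.

Lemma alpha_inside z : normc z < 1 ->
  alpha lnf z = Cexp (- pseries_sum (fun m => laurent_coef lnf m%:Z) (z ^ 1)).
Proof. by move=> z1; rewrite /alpha normrE -[1]/(1%:C) ltcR z1. Qed.

(** The inverse gives [alpha s / alpha z] outside the shape of
    [alpha z / alpha s] inside. *)
Lemma alpha_outside z : 1 < normc z ->
  alpha lnf z = (Cexp (- pseries_sum cout (z ^ (- 1))))^-1.
Proof.
move=> z1; rewrite /alpha normrE -[1 in X in if X then _ else _]/(1%:C).
rewrite ltcR ltNge (ltW z1) /= -[1 in X in if X then _ else _]/(1%:C) ltcR z1.
have E : (fun n => psum cout n (z ^ (- 1)) : R[i]^o) =
    (fun n => \sum_(1 <= m < n) laurent_coef lnf (- m%:Z) * z ^ (- m%:Z) : R[i]^o).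
  apply/funext => -[|n]; first by rewrite /psum !big_geq.
  rewrite /psum big_ltn // mul0r add0r; apply: eq_big_nat => -[//|m] _.
  by rewrite /cout exprz_exp mulN1r.
by rewrite -CexpN opprK /pseries_sum E.
Qed.

(* A radius strictly between 1 and the radius of convergence of the series. *)
Let r := expR (d / 2).

Let q_r : expR (- d) * r < 1.
Proof. by rewrite -expRD -[X in _ < X]expR0 ltr_expR addrC subr_lt0 ltr_pdivrMr // mulr_natr mulr2n ltrDl. Qed.

Let q1 : expR (- d) < 1.
Proof. by rewrite -[X in _ < X]expR0 ltr_expR oppr_lt0. Qed.

Let r1 : 1 < r.
Proof. by rewrite -[X in X < _]expR0 ltr_expR divr_gt0. Qed.

Variables etaz etas : R.
Hypotheses (etas0 : 0 < etas) (etasz : etas < etaz) (etaz1 : etaz < 1).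

Lemma inside_bound : exists2 K : R, 0 <= K & forall u v : int,
  normc (oint etaz (fun z => oint etas (fun s =>
    alpha lnf z / alpha lnf s * (s ^ u * z ^ v / (z - s))))) <=
  K * (r ^ v * etas ^ u).
Proof.
have etaz0 : 0 < etaz by exact: lt_trans etasz.
have etas1 : etas < 1 by exact: lt_trans etaz1.
have r0 : 0 < r by exact: expR_gt0.
have qe x : 0 < x -> x < 1 -> expR (- d) * x < 1.
  by move=> x0 x1; rewrite -[1]mulr1 ltr_pM // ?expR_ge0 // ltW.
have [K K0 HK] := @normc_exp_kernel_le R _ A (expR (- d)) etaz etas r 1 1
  (normc1 _) (expR_ge0 _) cP etaz0 etas0 r0 (qe _ etaz0 etaz1) (qe _ etas0 etas1) q_r etasz
  (lt_trans etas1 r1).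
exists (K / r); first by rewrite divr_ge0 // ltW.
move=> u v; have := HK (v - 1) u.
have -> : K * (r ^ (v - 1) * etas ^ u) = K / r * (r ^ v * etas ^ u).
  by rewrite expfzDr ?gt_eqF // exprN1; ring.
set lhs := oint _ _; set rhs := oint _ _.
suff -> : lhs = rhs by [].
apply: eq_oint => [|z zr]; first exact: ltW.
apply: eq_oint => [|s sr]; first exact: ltW.
have z0 : z != 0 by rewrite -normc_gt0 zr.
have zs : z - s != 0.
  by rewrite subr_eq0; apply: contraTneq etasz => zsE; rewrite -zr -sr zsE ltxx.
have z1 : normc z < 1 by rewrite zr.
have s1 : normc s < 1 by rewrite sr.
exact: (inside_kernelE u v (alpha_inside z1) (alpha_inside s1) (Cexp_neq0 _) z0 zs).
Qed.

Lemma outside_bound : exists2 K : R, 0 <= K & forall u v : int,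
  normc (oint etaz^-1 (fun z => oint etas^-1 (fun s =>
    alpha lnf s / alpha lnf z * (s ^ u * z ^ v / (z - s))))) <=
  K * (r ^ (- v) * etas ^ (- u)).
Proof.
have etaz0 : 0 < etaz by exact: lt_trans etasz.
have etas1 : etas < 1 by exact: lt_trans etaz1.
have r0 : 0 < r by exact: expR_gt0.
have rV0 : 0 < r^-1 by rewrite invr_gt0.
have etazV0 : 0 < etaz^-1 by rewrite invr_gt0.
have etasV0 : 0 < etas^-1 by rewrite invr_gt0.
have qe x : 0 < x -> x < 1 -> expR (- d) * x^-1 ^ (-1) < 1.
  move=> x0 x1; rewrite exprN1 invrK.
  by rewrite -[1]mulr1 ltr_pM // ?expR_ge0 // ltW.
have qrV : expR (- d) * r^-1 ^ (-1) < 1 by rewrite exprN1 invrK.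
have sz : etas^-1 ^ (-1) < etaz^-1 ^ (-1) by rewrite !exprN1 !invrK.
have sr' : etas^-1 ^ (-1) < r^-1 ^ (-1).
  by rewrite !exprN1 !invrK (lt_trans etas1).
have N1 : normc (- 1 : R[i]) = 1 by rewrite normc_opp normc1.
have [K K0 HK] := @normc_exp_kernel_le R _ A (expR (- d)) etaz^-1 etas^-1 r^-1
  (- 1) (- 1) N1 (expR_ge0 _) cout_bound etazV0 etasV0 rV0 (qe _ etaz0 etaz1) (qe _ etas0 etas1)
  qrV sz sr'.
exists (K * etas); first by rewrite mulr_ge0 // ltW.
move=> u v; have := HK v (u - 1).
have -> : K * (r^-1 ^ v * etas^-1 ^ (u - 1)) = K * etas * (r ^ (- v) * etas ^ (- u)).
  rewrite !exprz_inv opprB addrC expfzDr ?gt_eqF //; ring.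
set lhs := oint _ _; set rhs := oint _ _.
suff -> : lhs = rhs by [].
apply: eq_oint => [|z zr]; first exact: ltW.
apply: eq_oint => [|s sr]; first exact: ltW.
have z0 : z != 0 by rewrite -normc_gt0 zr.
have s0 : s != 0 by rewrite -normc_gt0 sr.
have zs : z - s != 0.
  rewrite subr_eq0; apply: contraTneq etasz => zsE.
  by rewrite -[etas]invrK -[etaz]invrK -zr -sr zsE ltxx.
have z1 : 1 < normc z by rewrite zr invf_gt1.
have s1 : 1 < normc s by rewrite sr invf_gt1.
exact: (outside_kernelE u v (alpha_outside z1) (alpha_outside s1)
  (Cexp_neq0 _) (Cexp_neq0 _) s0 zs).
Qed.

End SzegoBounds.

(** * Geometric closeness of sequences *)

Section GeometricCloseness.
Variables (R : realType) (q : R).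
Hypotheses (q0 : 0 < q) (q1 : q < 1).
Implicit Types (u : nat -> R[i]) (v : R[i]).

(** The bound is required for every [N], not only eventually, so that constants
    add and multiply without thresholds; [C >= 0] follows from [N = 0]. *)
Definition geo_close u v := exists C : R, forall N, normc (u N - v) <= C * q ^+ N.

Let qN0 N : 0 <= q ^+ N. Proof. by rewrite exprn_ge0 // ltW. Qed.

Lemma geo_close_ge0 (C : R) u v : (forall N, normc (u N - v) <= C * q ^+ N) -> 0 <= C.
Proof. by move=> /(_ 0%N); rewrite expr0 mulr1; apply: le_trans; exact: normc_ge0. Qed.

Lemma geo_close_cst v : geo_close (fun=> v) v.
Proof. by exists 0 => N; rewrite subrr mul0r (_ : normc 0 = 0) //; apply/eqP; rewrite normc_eq0. Qed.

Lemma geo_closeD u1 v1 u2 v2 : geo_close u1 v1 -> geo_close u2 v2 ->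
  geo_close (fun N => u1 N + u2 N) (v1 + v2).
Proof.
move=> [C1 H1] [C2 H2]; exists (C1 + C2) => N.
have -> : u1 N + u2 N - (v1 + v2) = (u1 N - v1) + (u2 N - v2) by ring.
by apply: (le_trans (normc_triangle _ _)); rewrite mulrDl lerD.
Qed.

Lemma geo_closeM u1 v1 u2 v2 : geo_close u1 v1 -> geo_close u2 v2 ->
  geo_close (fun N => u1 N * u2 N) (v1 * v2).
Proof.
move=> [C1 H1] [C2 H2].
have C10 := geo_close_ge0 H1; have C20 := geo_close_ge0 H2.
exists (C1 * C2 + normc v1 * C2 + C1 * normc v2) => N.
have -> : u1 N * u2 N - v1 * v2 =
    (u1 N - v1) * (u2 N - v2) + v1 * (u2 N - v2) + (u1 N - v1) * v2 by ring.
apply: (le_trans (normc_triangle _ _)).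
rewrite [X in _ <= X]mulrDl [X in _ <= X + _]mulrDl; apply: lerD.
  apply: (le_trans (normc_triangle _ _)); apply: lerD.
    rewrite normcM; apply: (le_trans (ler_pM _ _ (H1 N) (H2 N))); rewrite ?normc_ge0 //.
    have -> : C1 * q ^+ N * (C2 * q ^+ N) = C1 * C2 * q ^+ N * q ^+ N by ring.
    by rewrite ler_piMr ?mulr_ge0 // exprn_ile1 // ltW.
  by rewrite normcM -mulrA ler_wpM2l ?normc_ge0.
by rewrite normcM mulrAC ler_wpM2r ?normc_ge0.
Qed.

Lemma geo_close_sum (I : Type) (s : seq I) (F : nat -> I -> R[i]) (G : I -> R[i]) :
  (forall i, geo_close (F ^~ i) (G i)) ->
  geo_close (fun N => \sum_(i <- s) F N i) (\sum_(i <- s) G i).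
Proof.
move=> FG; elim: s => [|i s IH].
  rewrite big_nil; have -> : (fun N => \sum_(i <- [::]) F N i) = (fun=> 0).
    by apply/funext => N; rewrite big_nil.
  exact: geo_close_cst.
rewrite big_cons; have -> : (fun N => \sum_(i <- i :: s) F N i) =
    (fun N => F N i + \sum_(i <- s) F N i).
  by apply/funext => N; rewrite big_cons.
exact: geo_closeD.
Qed.

Lemma geo_close_prod (I : Type) (s : seq I) (F : nat -> I -> R[i]) (G : I -> R[i]) :
  (forall i, geo_close (F ^~ i) (G i)) ->
  geo_close (fun N => \prod_(i <- s) F N i) (\prod_(i <- s) G i).
Proof.
move=> FG; elim: s => [|i s IH].
  rewrite big_nil; have -> : (fun N => \prod_(i <- [::]) F N i) = (fun=> 1).
    by apply/funext => N; rewrite big_nil.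
  exact: geo_close_cst.
rewrite big_cons; have -> : (fun N => \prod_(i <- i :: s) F N i) =
    (fun N => F N i * \prod_(i <- s) F N i).
  by apply/funext => N; rewrite big_cons.
exact: geo_closeM.
Qed.

(** The determinant is a polynomial in the entries. *)
Lemma geo_close_det n (A : nat -> 'M[R[i]]_n) (B : 'M[R[i]]_n) :
  (forall i j, geo_close (fun N => A N i j) (B i j)) ->
  geo_close (fun N => \det (A N)) (\det B).
Proof.
move=> AB; apply: (@geo_close_sum _ _ (fun N (s : 'S_n) =>
  (-1) ^+ s * \prod_i A N i (s i))) => s.
apply: (@geo_closeM (fun=> (-1) ^+ s)); first exact: geo_close_cst.
exact: (@geo_close_prod _ _ (fun N i => A N i (s i))).
Qed.

(** Exponential decay beats every power: [x <= exp x] at [x = y N / m], where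
    [q = exp (- y)]. *)
Lemma natr_exp_geo_le m : (0 < m)%N ->
  exists2 K : R, 0 < K & forall N, N%:R ^+ m * q ^+ N <= K.
Proof.
move=> m0; pose y := - ln q; have y0 : 0 < y by rewrite oppr_gt0 ln_lt0 // q0.
have qE : q = expR (- y) by rewrite /y opprK lnK.
have mR : (0 : R) < m%:R by rewrite ltr0n.
exists ((m%:R / y) ^+ m) => [|N]; first by rewrite exprn_gt0 // divr_gt0.
pose x := y * N%:R / m%:R.
have x0 : 0 <= x by rewrite divr_ge0 ?mulr_ge0 // ltW.
have xe : x <= expR x by apply: le_trans (expR_ge1Dx x); rewrite lerDr.
have NE : N%:R = m%:R / y * x by rewrite /x; field; rewrite !gt_eqF.
have qNE : q ^+ N = expR (- x) ^+ m.
  rewrite qE -!expRM_natl; congr expR; rewrite /x; field.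
  by rewrite gt_eqF.
have my0 : 0 <= (m%:R / y) ^+ m by rewrite exprn_ge0 // divr_ge0 // ltW.
rewrite {1}NE exprMn qNE -mulrA -exprMn ler_piMr //.
have h1 : 0 <= x * expR (- x) by rewrite mulr_ge0 ?expR_ge0.
have h2 : x * expR (- x) <= 1 by rewrite expRN ler_pdivrMr ?expR_gt0 // mul1r.
exact: exprn_ile1.
Qed.

Lemma geo_close_bigO u : geo_close u 0 -> bigO_inv_powers u.
Proof.
move=> [C HC] m m0; have C0 := geo_close_ge0 HC.
have [K K0 HK] := natr_exp_geo_le m0.
apply/eqO_exP; exists ((C + 1) * K)%:C.
  by rewrite ltcR mulr_gt0 // ltr_wpDl.
exists 1%N => // N /= N0.
have NR : (0 : R) < N%:R by rewrite ltr0n.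
have nN : normc (N%:R : R[i]) = N%:R.
  by rewrite -(rmorph_nat (real_complex R)) normc_real ger0_norm // ltW.
rewrite !normrE normcV normcX nN -rmorphM lecR.
have := HC N; rewrite subr0 => /le_trans; apply.
rewrite ler_pdivlMr ?exprn_gt0 // -mulrA [q ^+ N * _]mulrC.
apply: (@le_trans _ _ (C * K)); first by rewrite ler_wpM2l.
by rewrite ler_pM2r // lerDl.
Qed.

End GeometricCloseness.

Section Entries.
Variables (R : realType) (q r etas : R).
Hypotheses (r0 : 0 < r) (rq : r^-1 <= q) (etas0 : 0 < etas) (etasq : etas <= q).
Hypothesis q1 : q < 1.

Let q0 : 0 < q. Proof. exact: lt_le_trans etasq. Qed.

(** The flags [b1] and [b2] say in which of the two exponents [N] occurs. Each
    occurrence contributes a factor at most [q ^ N <= 1], so one suffices. *)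
Lemma geo_close_of_le (K : R) (u : nat -> R[i]) (k l : int) (b1 b2 : bool) :
  0 <= K -> b1 || b2 ->
  (forall N, normc (u N) <= K * (r ^ (if b1 then k - N%:Z else k) *
     etas ^ (if b2 then N%:Z + l else l))) ->
  geo_close q u 0.
Proof.
move=> K0 b12 H; exists (K * (r ^ k * etas ^ l)) => N; rewrite subr0.
apply: (le_trans (H N)).
have rk : 0 < r ^ k by exact: exprz_gt0.
have el : 0 < etas ^ l by exact: exprz_gt0.
have -> : r ^ (if b1 then k - N%:Z else k) = r ^ k * (if b1 then r^-1 ^+ N else 1).
  by case: b1 {b12 H}; rewrite ?mulr1 // expfzDr ?gt_eqF // -exprz_inv.
have -> : etas ^ (if b2 then N%:Z + l else l) =
    etas ^ l * (if b2 then etas ^+ N else 1).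
  by case: b2 {b12 H}; rewrite ?mulr1 // expfzDr ?gt_eqF // mulrC.
have rN : 0 <= r^-1 ^+ N <= q ^+ N.
  by rewrite exprn_ge0 ?invr_ge0 ?(ltW r0) //= lerXn2r // nnegrE ?invr_ge0 ltW.
have eN : 0 <= etas ^+ N <= q ^+ N.
  by rewrite exprn_ge0 ?(ltW etas0) //= lerXn2r // nnegrE ltW.
have qN : q ^+ N <= 1 by rewrite exprn_ile1 // ltW.
have -> : K * (r ^ k * (if b1 then r^-1 ^+ N else 1) *
     (etas ^ l * (if b2 then etas ^+ N else 1))) =
   K * (r ^ k * etas ^ l) *
   ((if b1 then r^-1 ^+ N else 1) * (if b2 then etas ^+ N else 1)) by ring.
apply: ler_wpM2l; first by rewrite !mulr_ge0 // ltW.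
case/andP: rN => rN0 rN; case/andP: eN => eN0 eN.
case: b1 b2 b12 {H} => [] [] // _; rewrite ?mulr1 ?mul1r //.
rewrite -[q ^+ N]mulr1; apply: ler_pM => //; exact: le_trans qN.
Qed.

End Entries.

(** * Asymptotics of the matrix and of its determinant *)

Lemma eq_double_oint (R : realType) (rz rs : R) (g h : R[i] -> R[i] -> R[i]) :
  (forall z s, g z s = h z s) ->
  oint rz (fun z => oint rs (g z)) = oint rz (fun z => oint rs (h z)).
Proof.
by move=> gh; have -> : g = h by apply/funext => z; apply/funext => s; exact: gh.
Qed.

Section MatrixAsymptotics.
Variables (R : realType) (lnf : R[i] -> R[i]) (etaz etas r q K : R).
Variables (nm np : nat) (pm hm : 'I_nm -> int) (pp hp : 'I_np -> int).
Hypotheses (pm1 : forall a, 1 <= pm a) (pp1 : forall a, 1 <= pp a).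
Hypotheses (etas0 : 0 < etas) (etasz : etas < etaz) (r0 : 0 < r).
Hypotheses (rq : r^-1 <= q) (etasq : etas <= q) (q1 : q < 1) (K0 : 0 <= K).

Let Din (u v : int) : R[i] := oint etaz (fun z => oint etas (fun s =>
  alpha lnf z / alpha lnf s * (s ^ u * z ^ v / (z - s)))).

Let Dout (u v : int) : R[i] := oint etaz^-1 (fun z => oint etas^-1 (fun s =>
  alpha lnf s / alpha lnf z * (s ^ u * z ^ v / (z - s)))).

Hypothesis Din_le : forall u v, normc (Din u v) <= K * (r ^ v * etas ^ u).
Hypothesis Dout_le : forall u v, normc (Dout u v) <= K * (r ^ (- v) * etas ^ (- u)).

Let close_of_le := @geo_close_of_le R q r etas r0 rq etas0 etasq q1 K.

Let M N := Mmx lnf etaz etas N (particles pm pp N) (holes hm hp N).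

Let M_E N a b : M N a b =
  - indN R (particles pm pp N a) *
    Din (N%:Z - particles pm pp N a) (holes hm hp N b - N%:Z - 1) +
  indN R (- particles pm pp N a) *
    Dout (- particles pm pp N a) (holes hm hp N b - 1).
Proof. by rewrite mxE. Qed.

Let particles_l N i : particles pm pp N (lshift np i) = 1 - pm i.
Proof. by rewrite /particles (unsplitK (inl i)). Qed.

Let particles_r N i : particles pm pp N (rshift nm i) = pp i + N%:Z.
Proof. by rewrite /particles (unsplitK (inr i)). Qed.

Let holes_l N i : holes hm hp N (lshift np i) = hm i.
Proof. by rewrite /holes (unsplitK (inl i)). Qed.

Let holes_r N i : holes hm hp N (rshift nm i) = N%:Z + 1 - hp i.
Proof. by rewrite /holes (unsplitK (inr i)). Qed.

Let indN_l N i : indN R (- particles pm pp N (lshift np i)) = 1.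
Proof. by rewrite particles_l /indN opprB subr_ge0 pm1. Qed.

Let indN_r N i : indN R (- particles pm pp N (rshift nm i)) = 0 /\
  indN R (particles pm pp N (rshift nm i)) = 1.
Proof.
rewrite particles_r /indN.
have h : 0 < pp i + N%:Z by rewrite ltr_wpDr // (lt_le_trans _ (pp1 i)).
by rewrite (ltW h) oppr_ge0 leNgt h.
Qed.

Let Mminus_E i j : Mminus lnf etaz etas pm hm i j = Dout (pm i - 1) (hm j - 1).
Proof.
rewrite mxE; apply: (@eq_double_oint R etaz^-1 etas^-1
  (fun z s => s ^ (pm i - 1) * z ^ (hm j - 1) / (z - s) *
     (alpha lnf s / alpha lnf z))) => z s.
exact: mulrC.
Qed.

Let Mplus_E i j : Mplus lnf etaz etas pp hp i j = - Din (- pp i) (- hp j).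
Proof.
rewrite mxE; apply: (congr1 -%R); apply: (@eq_double_oint R etaz etas
  (fun z s => s ^ (- pp i) * z ^ (- hp j) / (z - s) *
     (alpha lnf z / alpha lnf s))) => z s.
exact: mulrC.
Qed.

(* For [p <= 0] the first term of the entry is present only if [p = 0], and it is
   negligible whatever the value of the indicator function. *)
Let geo_close_indN (p : int) (u : nat -> R[i]) : geo_close q u 0 ->
  geo_close q (fun N => - indN R p * u N) 0.
Proof.
move=> u0; have qpos : 0 < q by exact: lt_le_trans etasq.
have := geo_closeM qpos q1 (geo_close_cst q (- indN R p)) u0.
by rewrite [X in geo_close _ _ X]mulr0.
Qed.

(** The diagonal blocks of [M] converge to [Mminus] and [Mplus], the
    off-diagonal ones to 0, because every discrepancy contains [z ^ (- N)] on a
    circle movable outside the unit disc, [z ^ N] on one movable inside, or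
    [s ^ N] on a circle inside. *)
Lemma geo_close_Mmx a b : geo_close q (fun N => M N a b)
  (block_mx (Mminus lnf etaz etas pm hm) 0 0 (Mplus lnf etaz etas pp hp) a b).
Proof.
have qpos : 0 < q by exact: lt_le_trans etasq.
rewrite -(splitK a) -(splitK b).
case: (fintype.split a) => i; case: (fintype.split b) => j /=.
- have -> : (fun N => M N (lshift np i) (lshift np j)) = (fun N =>
      - indN R (1 - pm i) * Din (N%:Z + (pm i - 1)) (hm j - 1 - N%:Z) +
      Dout (pm i - 1) (hm j - 1)).
    apply/funext => N; rewrite M_E indN_l mul1r particles_l holes_l.
    by rewrite !opprB addrAC.
  rewrite block_mxEul Mminus_E -[X in geo_close _ _ X]add0r.
  apply: geo_closeD; last exact: geo_close_cst.
  apply: geo_close_indN.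
  exact: (@close_of_le _ (hm j - 1) (pm i - 1) true true K0).
- have -> : (fun N => M N (lshift np i) (rshift nm j)) = (fun N =>
      - indN R (1 - pm i) * Din (N%:Z + (pm i - 1)) (- hp j) +
      Dout (pm i - 1) (N%:Z - hp j)).
    apply/funext => N; rewrite M_E indN_l mul1r particles_l holes_r.
    have -> : N%:Z + 1 - hp j - N%:Z - 1 = - hp j by ring.
    have -> : N%:Z + 1 - hp j - 1 = N%:Z - hp j by ring.
    by rewrite !opprB.
  rewrite block_mxEur mxE -[X in geo_close _ _ X]add0r.
  apply: geo_closeD.
    apply: geo_close_indN.
    exact: (@close_of_le _ (- hp j) (pm i - 1) false true K0).
  apply: (@close_of_le _ (hp j) (1 - pm i) true false K0 isT) => N.
  have := Dout_le (pm i - 1) (N%:Z - hp j); rewrite !opprB.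
  exact.
- have -> : (fun N => M N (rshift nm i) (lshift np j)) = (fun N =>
      - 1 * Din (- pp i) (hm j - 1 - N%:Z)).
    apply/funext => N; have [i0 i1] := indN_r N i.
    rewrite M_E i0 i1 mul0r addr0 particles_r holes_l.
    have -> : N%:Z - (pp i + N%:Z) = - pp i by ring.
    by have -> : hm j - N%:Z - 1 = hm j - 1 - N%:Z by ring.
  rewrite block_mxEdl mxE.
  apply: (@close_of_le _ (hm j - 1) (- pp i) true false K0 isT) => N.
  by rewrite mulN1r normc_opp; exact: Din_le.
have -> : (fun N => M N (rshift nm i) (rshift nm j)) =
    (fun N => - Din (- pp i) (- hp j)).
  apply/funext => N; have [i0 i1] := indN_r N i.
  rewrite M_E i0 i1 mul0r addr0 mulN1r particles_r holes_r.
  have -> : N%:Z - (pp i + N%:Z) = - pp i by ring.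
  by have -> : N%:Z + 1 - hp j - N%:Z - 1 = - hp j by ring.
rewrite block_mxEdr Mplus_E; exact: geo_close_cst.
Qed.

End MatrixAsymptotics.

Theorem corollary0p1 (R : realType) (f lnf : R[i] -> R[i]) (U : set R[i])
    (hU : open_nbhs_unit_circle U)
    (hf0 : forall z : R[i], `|z| = 1 -> f z != 0)
    (hf : holomorphic_on U f)
    (hlnf : holomorphic_log U f lnf)
    (nm np : nat)
    (pm hm : 'I_nm -> int) (pp hp : 'I_np -> int)
    (hpm1 : forall a, 1 <= pm a) (hhm1 : forall a, 1 <= hm a)
    (hpp1 : forall a, 1 <= pp a) (hhp1 : forall a, 1 <= hp a)
    (etaz etas : R) (hetas : 0 < etas) (hetazs : etas < etaz) (hetaz : etaz < 1)
    (hMplus : Mplus lnf etaz etas pp hp \in unitmx)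
    (hMminus : Mminus lnf etaz etas pm hm \in unitmx) :
  exists rem : nat -> R[i],
    bigO_inv_powers rem /\
    (forall N : nat, admissible pm pp hm hp N ->
       \det (Mmx lnf etaz etas N (particles pm pp N) (holes hm hp N))
       = \det (Mplus lnf etaz etas pp hp) * \det (Mminus lnf etaz etas pm hm)
         * (1 + rem N)).
Proof.
have [d [A [d0 cP cN]]] := laurent_coef_decay hU hlnf.1.
have [K1 K10 HK1] := inside_bound d0 cP hetas hetazs hetaz.
have [K2 K20 HK2] := outside_bound d0 cP cN hetas hetazs hetaz.
pose r := expR (d / 2); pose q := Num.max r^-1 etas; pose K := Num.max K1 K2.
have r0 : 0 < r by exact: expR_gt0.
have etas1 : etas < 1 by exact: lt_trans hetaz.
have r1 : 1 < r by rewrite -[X in X < _]expR0 ltr_expR divr_gt0.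
have q1 : q < 1 by rewrite gt_max invf_lt1 // r1.
have rq : r^-1 <= q by rewrite le_max lexx.
have eq : etas <= q by rewrite le_max lexx orbT.
have q0 : 0 < q by exact: lt_le_trans eq.
have K0 : 0 <= K by rewrite le_max K10.
have le1 k l : K1 * (r ^ k * etas ^ l) <= K * (r ^ k * etas ^ l).
  by rewrite ler_wpM2r ?mulr_ge0 ?exprz_ge0 ?(ltW r0) ?(ltW hetas) // le_max lexx.
have le2 k l : K2 * (r ^ k * etas ^ l) <= K * (r ^ k * etas ^ l).
  by rewrite ler_wpM2r ?mulr_ge0 ?exprz_ge0 ?(ltW r0) ?(ltW hetas) // le_max lexx orbT.
have close := geo_close_det q0 q1 (@geo_close_Mmx R lnf etaz etas r q K nm np
  pm hm pp hp hpm1 hpp1 hetas r0 rq eq q1 K0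
  (fun u v => le_trans (HK1 u v) (le1 _ _)) (fun u v => le_trans (HK2 u v) (le2 _ _))).
move: close; rewrite det_ublock mulrC.
set D := _ * _ => close.
have D0 : D != 0.
  by move: hMplus hMminus; rewrite !unitmxE !unitfE; exact: mulf_neq0.
exists (fun N =>
  \det (Mmx lnf etaz etas N (particles pm pp N) (holes hm hp N)) * D^-1 - 1).
split; last by move=> N _; rewrite addrC subrK mulrC divfK.
apply: (geo_close_bigO q0 q1).
have -> : (0 : R[i]) = D * D^-1 - 1 by rewrite divff // subrr.
apply: geo_closeD; last exact: geo_close_cst.
by apply: (geo_closeM q0 q1) => //; exact: geo_close_cst.
Qed.
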